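(* Let $d,s,n$ be positive integers, $f_0^*:\{\pm1\}^s\to\mathbb R$, $S^*\subset[d]$ with $|S^*|=s$, $f^*(\mathbf x)=f_0^*(\mathbf x_{S^*})$. Observe $\mathcal D_n=\{(\mathbf X_i,Y_i)\}_{i=1}^n$, $\mathbf X_i$ i.i.d. uniform on $\{\pm1\}^d$, $Y_i=f^*(\mathbf X_i)+\varepsilon_i$, $\varepsilon_i$ i.i.d. zero-mean independent of covariates and sub-Gaussian with parameter $\sigma$. Suppose $f^*\in\mathsf{SMSP}(\lambda)$, $\lambda>0$. Fix $0<\delta<1$, let $\tau=18(9\|f^*\|_\infty^2+\sigma^2)((s+2)\log3+\log(2d/\delta))$, suppose $n>8\tau/\lambda$, and fit $\hat f_{\mathrm{CART}}$ with minimum impurity decrease threshold $\gamma$ satisfying $\frac\tau n\le\gamma<(\sqrt{\lambda/2}-\sqrt{\tau/n})_+^2$ (such $\gamma$ exists). Then with probability at least $1-\delta-\exp(s\log3-n2^{-s-3})$, $$R(\hat f_{\mathrm{CART}}(\cdot;\mathcal D_n),f^* )\le\frac{2^{s+1}(\|f^*\|_\infty^2+\sigma^2)((s+1)\log3+\log(2/\delta))}{n}.$$ Moreover, under the same conditions with the choice $\delta=1/n$, $\mathfrak R(\hat f_{\mathrm{CART}},f_0^*,d,n)=O\big(2^s(\|f^*\|_\infty^2+\sigma^2)(s+\log n)/n\big)$ with a universal constant.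
   Context: $\mathbf X$ uniform on $\{\pm1\}^d$; $R(g,f^* )=\mathbb E_{\mathbf X}\{(g(\mathbf X)-f^*(\mathbf X))^2\}$, $\mathfrak R=\mathbb E_{\mathcal D_n}R(\hat f(\cdot;\mathcal D_n),f^* )$. Cells: $C=\{\mathbf x:x_j=z_j,\ j\in J(C)\}$; $C_{k,\pm}=C\cap\{x_k=\pm1\}$ for $k\notin J(C)$. $I(C)=\{i:\mathbf X_i\in C\}$, $N(C)=|I(C)|$, $\bar Y_C$ the mean response over $I(C)$, $\mathcal I(C)=\frac1{N(C)}\sum_{i\in I(C)}(Y_i-\bar Y_C)^2$, $\hat\Delta(k;C)=\mathcal I(C)-\frac{N(C_{k,+})}{N(C)}\mathcal I(C_{k,+})-\frac{N(C_{k,-})}{N(C)}\mathcal I(C_{k,-})$. CART grows top-down from $\{\pm1\}^d$: $C$ becomes a leaf if $\frac{N(C)}{n}\max_{k\notin J(C)}\hat\Delta(k;C)<\gamma$, else it is split on $\arg\max_{k\notin J(C)}\hat\Delta(k;C)$; leaves are labeled by mean responses. $f^*\in\mathsf{SMSP}(\lambda)$: for every cell $C$ on which $f^*$ is not constant, $\max_{k\in[d]\setminus J(C)}\operatorname{Cov}^2\{f^*(\mathbf X),X_k\mid\mathbf X\in C\}\,2^{-|J(C)\cap S^*|}\ge\lambda$. *)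

(* Defs.v *)
From HB Require Import structures.
From mathcomp Require Import all_boot all_order all_algebra.
From mathcomp Require Import all_classical all_reals all_analysis.
Set Implicit Arguments. Unset Strict Implicit. Unset Printing Implicit Defensive.
Import Order.TTheory GRing.Theory Num.Theory.
Import numFieldNormedType.Exports.
Local Open Scope classical_set_scope.
Local Open Scope ring_scope.

(* Points of {+-1}^d : x j = true encodes x_j = +1, false encodes x_j = -1. *)
Definition cube (d : nat) := {ffun 'I_d -> bool}.
Definition spin {R : realType} (b : bool) : R := if b then 1 else -1.

(* A cell C = {x : x_j = z_j, j in J(C)} is encoded by c : 'I_d -> option bool:
   c j = Some z_j for j in J(C), c j = None for free coordinates. *)
Definition cell (d : nat) := {ffun 'I_d -> option bool}.
Definition in_cell d (C : cell d) (x : cube d) : bool :=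
  [forall j, if C j is Some b then x j == b else true].
Definition Jcell d (C : cell d) : {set 'I_d} := [set j | C j != None].
Definition root_cell d : cell d := [ffun _ => None].
Definition split_cell d (C : cell d) (k : 'I_d) (b : bool) : cell d :=
  [ffun j => if j == k then Some b else C j].

Section CART.
Variables (R : realType) (d n : nat) (Xs : 'I_n -> cube d) (Ys : 'I_n -> R).

Definition Ncell (C : cell d) : nat := #|[set i | in_cell C (Xs i)]|.
Definition mean_resp (C : cell d) : R :=
  (Ncell C)%:R^-1 * \sum_(i | in_cell C (Xs i)) Ys i.
Definition impurity (C : cell d) : R :=
  (Ncell C)%:R^-1 * \sum_(i | in_cell C (Xs i)) (Ys i - mean_resp C) ^+ 2.
Definition imp_decrease (k : 'I_d) (C : cell d) : R :=
  impurity C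
  - (Ncell (split_cell C k true))%:R / (Ncell C)%:R * impurity (split_cell C k true)
  - (Ncell (split_cell C k false))%:R / (Ncell C)%:R * impurity (split_cell C k false).
Definition best_split (C : cell d) : option 'I_d :=
  [pick k | (k \notin Jcell C) &&
     [forall k', (k' \notin Jcell C) ==> (imp_decrease k' C <= imp_decrease k C)]].

Variable gamma : R.
(* top-down CART evaluated at x : follow the path of cells containing x *)
Fixpoint cart_go (fuel : nat) (C : cell d) (x : cube d) : R :=
  match fuel with
  | 0 => mean_resp C
  | fuel'.+1 =>
    match best_split C with
    | None => mean_resp C
    | Some k =>
      if (Ncell C)%:R / n%:R * imp_decrease k C < gamma then mean_resp C
      else cart_go fuel' (split_cell C k (x k)) x
    end
  end.
Definition cart (x : cube d) : R := cart_go d.+1 (root_cell d) x.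
End CART.

Section Target.
Variable R : realType.

Definition risk d (g f : cube d -> R) : R :=
  ((2 ^ d)%:R)^-1 * \sum_(x : cube d) (g x - f x) ^+ 2.
Definition supnorm d (f : cube d -> R) : R := \big[Num.max/0]_(x : cube d) `|f x|.

(* f*(x) = f0*(x_{S*}) with S* = e('I_s), e injective *)
Definition fstar d s (f0 : cube s -> R) (e : 'I_s -> 'I_d) (x : cube d) : R :=
  f0 [ffun k => x (e k)].
Definition Sstar d s (e : 'I_s -> 'I_d) : {set 'I_d} := [set e k | k in 'I_s].

Definition cell_avg d (C : cell d) (g : cube d -> R) : R :=
  (#|[set x | in_cell C x]|%:R)^-1 * \sum_(x | in_cell C x) g x.
Definition cell_cov d (f : cube d -> R) (k : 'I_d) (C : cell d) : R :=
  cell_avg C (fun x => f x * spin (x k)) - cell_avg C f * cell_avg C (fun x => spin (x k)).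

Definition SMSP d (f : cube d -> R) (S : {set 'I_d}) (lam : R) : Prop :=
  forall C : cell d,
    (exists x y, [/\ in_cell C x, in_cell C y & f x != f y]) ->
    exists k, k \notin Jcell C /\
      lam <= (cell_cov f k C) ^+ 2 / ((2 ^ #|Jcell C :&: S|)%:R).

Definition tau d s (M sigma delta : R) : R :=
  18 * (9 * M ^+ 2 + sigma ^+ 2) * ((s%:R + 2) * ln 3 + ln (2 * d%:R / delta)).

Definition cart_model (dT : measure_display) (T : measurableType dT)
  (P : probability T R) d n (X : 'I_n -> T -> cube d) (eps : 'I_n -> T -> R)
  (sigma : R) : Prop :=
  (forall i x, measurable (X i @^-1` [set x]) /\
                   P (X i @^-1` [set x]) = (((2 ^ d)%:R)^-1)%:E) /\
      (forall i, measurable_fun setT (eps i)) /\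
      (forall i, P.-integrable setT (EFin \o eps i) /\
                 (\int[P]_w (eps i w)%:E = 0)%E) /\
      (forall i (t : R), (\int[P]_w (expR (t * eps i w))%:E
                           <= (expR (sigma ^+ 2 * t ^+ 2 / 2))%:E)%E) /\
      (forall i j (B : set R), measurable B ->
                 P (eps i @^-1` B) = P (eps j @^-1` B)) /\
      (forall (A : 'I_n -> {set cube d}) (B : 'I_n -> set R),
         (forall i, measurable (B i)) ->
         P [set w | forall i, X i w \in A i /\ eps i w \in B i] =
         (\prod_(i < n) P [set w | X i w \in A i]
          * \prod_(i < n) P [set w | eps i w \in B i])%E).

Definition cart_risk (dT : measure_display) (T : measurableType dT)
  d s n (f0 : cube s -> R) (e : 'I_s -> 'I_d) (gamma : R)
  (X : 'I_n -> T -> cube d) (eps : 'I_n -> T -> R) (w : T) : R :=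
  risk (cart (fun i => X i w) (fun i => fstar f0 e (X i w) + eps i w) gamma)
       (fstar f0 e).
End Target.

(* Main.v *)
(** Conditionally on the design, a linear form in the noise is sub-Gaussian, so
    the mean of [exp (sum_i a_i(X) eps_i + b(X))] is at most an average over all
    designs of [exp (b + sigma^2/2 sum_i a_i^2)] ([expectation_exp_linear]).  All
    bad events are covered by one sum [Phi] of such exponentials, [Phi >= 1] on
    each of them, and [Phi] has mean at most [delta]; its three parts control
    - the sample counts of the cells on the relevant coordinates: by SMSP a cell
      [c] on which the target is not constant satisfies
      [lam 2^|J(c)| <= ||f||^2], so [n > 8 tau / lam] makes the expected counts
      of its children exceed [640 ((s+2) log 3 + log (2d/delta))];
    - the deviation of the split contrasts: [N(C)] times the impurity decrease
      is the square of [sum_i a_i Y_i] for a unit contrast vector [a], and after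
      centering the target in both children this form is sub-Gaussian given
      the labels [(1_C(X_i), X_ik)];
    - [sum_z S_z^2 / N_z] over the [2^s] atoms [z] of the relevant coordinates,
      through [exp (z^2/3 - 3/4) <= sum_j exp (2 j z - 3 j^2)], a discrete
      substitute for Gaussian linearization of the square.
    Off the bad events CART splits exactly the cells on which the target is not
    constant, and only on relevant coordinates; then the Cauchy-Schwarz
    inequality in each leaf bounds the risk by [16/(15 n) sum_z S_z^2 / N_z].
    A union bound over the leaves would lose a factor 2 in the final constant. *)

Require Import Defs.
From HB Require Import structures.
From mathcomp Require Import all_boot all_order all_algebra.
From mathcomp Require Import all_classical all_reals all_analysis.
From mathcomp Require Import measurable_realfun ring lra.
Import Order.TTheory GRing.Theory Num.Theory.
Import numFieldNormedType.Exports HBNNSimple.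
Local Open Scope classical_set_scope.
Local Open Scope ring_scope.
Set Implicit Arguments. Unset Strict Implicit. Unset Printing Implicit Defensive.

(** * Noise integrated out *)

(** [h] is a finite combination of indicators of its fibres, and the hypothesis evaluates the
    integral over each fibre. *)
Lemma integral_nnsfun_comp (R : realType) (dT : measure_display) (T : measurableType dT)
  (P : probability T R) (Y Z : T -> R) (c : R) (h : {nnsfun R >-> R}) :
  measurable_fun setT Y -> measurable_fun setT Z -> (forall w, 0 <= Z w) ->
  (forall B : set R, measurable B ->
     (\int[P]_w (\1_B (Y w) * Z w)%:E = c%:E * P (Y @^-1` B))%E) ->
  (\int[P]_w (h (Y w) * Z w)%:E =
   c%:E * \sum_(y \in range h) (y%:E * P (Y @^-1` (h @^-1` [set y]))))%E.
Proof.
move=> mY mZ Z0 H.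
have mI y : measurable_fun setT (fun w => \1_(h @^-1` [set y]) (Y w) * Z w).
  apply: measurable_funM => //; apply: (measurableT_comp _ mY).
  exact: measurable_indic.
transitivity (\int[P]_w (\sum_(y \in range h)
    (y * (\1_(h @^-1` [set y]) (Y w) * Z w))%:E))%E.
  apply: eq_integral => w _; rewrite fsumEFin//.
  rewrite (fimfunE h); congr EFin.
  by rewrite !fsbig_finite//= mulr_suml; apply: eq_bigr => y _; rewrite mulrA.
rewrite ge0_integral_fsum//=; last 2 first.
- by move=> y; apply/measurable_EFinP; apply: measurable_funM.
- move=> y w _; rewrite lee_fin mulrA mulr_ge0// -lee_fin EFinM.
  exact: nnfun_muleindic_ge0.
rewrite !fsbig_finite//= !big_seq ge0_sume_distrr; last first.
  move=> y; rewrite in_fset_set// inE => -[t _ <-].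
  by rewrite mule_ge0// lee_fin.
 apply: eq_bigr => y; rewrite in_fset_set// inE => -[t _ <-].
under eq_integral do rewrite EFinM.
rewrite ge0_integralZl_EFin//=; last 2 first.
- by move=> w _; rewrite lee_fin mulr_ge0.
- exact/measurable_EFinP.
by rewrite H// muleCA.
Qed.

(** The hypothesis says that under the weight [Z] the law of [Y] is multiplied by [c]. The factor
    passes from indicators to simple functions and, by monotone convergence, to nonnegative
    measurable [g]. *)
Lemma integral_comp_indep (R : realType) (dT : measure_display) (T : measurableType dT)
  (P : probability T R) (Y Z : T -> R) (c : R) (g : R -> R) :
  measurable_fun setT Y -> measurable_fun setT Z -> (forall w, 0 <= Z w) ->
  (forall B : set R, measurable B ->
     (\int[P]_w (\1_B (Y w) * Z w)%:E = c%:E * P (Y @^-1` B))%E) ->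
  measurable_fun setT g -> (forall y, 0 <= g y) ->
  (\int[P]_w (g (Y w) * Z w)%:E = c%:E * \int[P]_w (g (Y w))%:E)%E.
Proof.
move=> mY mZ Z0 H mg g0.
have mgE : measurable_fun setT (EFin \o g) by exact/measurable_EFinP.
pose h := nnsfun_approx measurableT mgE.
have hY k : (\int[P]_w (h k (Y w) * Z w)%:E = c%:E * \int[P]_w (h k (Y w))%:E)%E.
  rewrite (integral_nnsfun_comp (h k) mY mZ Z0 H).
  congr (_ * _)%E.
  (* The plain integral of [h k] along [Y] is the same formula with weight [1] and constant [1]. *)
  rewrite -[LHS]mul1e.
  rewrite -(@integral_nnsfun_comp _ _ _ P Y (cst 1) 1 (h k))//; last first.
    move=> B mB; under eq_integral do rewrite mulr1.
    rewrite mul1e (_ : (fun x => _) = (fun x => (\1_(Y @^-1` B) x)%:E)); last first.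
      by apply/funext => x; rewrite !indicE.
    rewrite integral_indic ?setIT//.
    by rewrite -[_ @^-1` _]setTI; exact: mY.
  by apply: eq_integral => w _; rewrite mulr1.
have mhY k : measurable_fun setT (fun w => h k (Y w)).
  by apply: (measurableT_comp _ mY).
have cvgh y : (h k y)%:E @[k --> \oo] --> (g y)%:E.
  by have := @cvg_nnsfun_approx _ _ _ _ measurableT _ mgE (fun x _ => g0 x) y I.
have ndh y : {homo (fun k => h k y) : a b / (a <= b)%N >-> a <= b}.
  by move=> a b ab; have /lefP := @nd_nnsfun_approx _ _ _ _ measurableT _ mgE a b ab; apply.
have c1 : (\int[P]_w (h k (Y w) * Z w)%:E)%E @[k --> \oo] --> (\int[P]_w (g (Y w) * Z w)%:E)%E.
  rewrite (_ : (fun w => (g (Y w) * Z w)%:E) =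
      (fun w => limn (fun k => (h k (Y w) * Z w)%:E))); last first.
    apply/funext => w; apply/esym/cvg_lim => //.
    under eq_fun do rewrite EFinM.
    by rewrite EFinM; apply: cvgeZr => //; exact: cvgh.
  apply: (@cvg_monotone_convergence _ _ _ P _ measurableT
    (fun k w => (h k (Y w) * Z w)%:E)) => //=.
  - by move=> k; apply/measurable_EFinP; apply: measurable_funM.
  - by move=> k w _; rewrite lee_fin mulr_ge0.
  - by move=> w _ a b ab; rewrite lee_fin ler_wpM2r// ndh.
have c2 : (\int[P]_w (h k (Y w))%:E)%E @[k --> \oo] --> (\int[P]_w (g (Y w))%:E)%E.
  rewrite (_ : (fun w => (g (Y w))%:E) =
      (fun w => limn (fun k => (h k (Y w))%:E))); last first.
    by apply/funext => w; apply/esym/cvg_lim => //; exact: cvgh.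
  apply: (@cvg_monotone_convergence _ _ _ P _ measurableT
    (fun k w => (h k (Y w))%:E)) => //=.
  - by move=> k; apply/measurable_EFinP.
  - by move=> k w _; rewrite lee_fin.
  - by move=> w _ a b ab; rewrite lee_fin ndh.
rewrite (funext hY) in c1.
by apply: (cvg_unique _ c1) => //; exact: cvgeZl.
Qed.

(** Serves wherever randomness enters through finitely many values, such as the design or the
    outcomes of comparisons: on each fibre of [Z] the function agrees with a fixed measurable
    one. *)
Lemma measurable_fun_finite_fibers (R : realType) (dT : measure_display)
  (T : measurableType dT) (F : finType) (Z : T -> F) (h : F -> T -> R) :
  (forall z, measurable (Z @^-1` [set z])) ->
  (forall z, measurable_fun setT (h z)) ->
  measurable_fun setT (fun w => h (Z w) w).
Proof.
move=> mZ mh.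
rewrite (_ : (fun _ => _) =
  (fun w => \sum_(z : F) \1_(Z @^-1` [set z]) w * h z w)); last first.
  apply/funext => w; rewrite (bigD1 (Z w))//= big1 => [|z zw].
    by rewrite indicE mem_set// mul1r addr0.
  rewrite indicE memNset ?mul0r// => /= e; by rewrite e eqxx in zw.
by apply: measurable_sum => z; apply: measurable_funM.
Qed.

Section Model.
Variables (R : realType) (dT : measure_display) (T : measurableType dT).
Variables (P : probability T R) (d n : nat).
Variables (X : 'I_n -> T -> cube d) (eps : 'I_n -> T -> R) (sigma : R).
Hypothesis model : cart_model P X eps sigma.

Definition design (w : T) : {ffun 'I_n -> cube d} := [ffun i => X i w].

Lemma measurable_design x : measurable (design @^-1` [set x]).
Proof.
have [mX _] := model.
rewrite (_ : _ @^-1` _ = \bigcap_(i in setT) (X i @^-1` [set x i])); last first.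
  apply/seteqP; split=> w /=.
    by move=> <- i _; rewrite /= ffunE.
  by move=> H; apply/ffunP => i; rewrite ffunE; exact: H.
by apply: fin_bigcap_measurable => // i _; have [] := mX i (x i).
Qed.

(** The model states independence for events only. The induction is on the number of factors allowed
    to be arbitrary, the others being indicators; each step frees one factor through
    [integral_comp_indep]. *)
Lemma integral_design_prod (x : {ffun 'I_n -> cube d}) (phi : 'I_n -> R -> R) (m : 'I_n -> R) :
  (forall i, measurable_fun setT (phi i)) -> (forall i y, 0 <= phi i y) ->
  (forall i, (\int[P]_w (phi i (eps i w))%:E = (m i)%:E)%E) ->
  (\int[P]_w ((design w == x)%:R * \prod_i phi i (eps i w))%:E =
   ((2 ^ d)%:R^-1 ^+ n * \prod_i m i)%:E)%E.
Proof.
have [mX [meps [_ [_ [_ indep]]]]] := model.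
suff H (k : nat) : forall (phi : 'I_n -> R -> R) (m : 'I_n -> R),
  (forall i, measurable_fun setT (phi i)) -> (forall i y, 0 <= phi i y) ->
  (forall i, (\int[P]_w (phi i (eps i w))%:E = (m i)%:E)%E) ->
  (forall i : 'I_n, (k <= i)%N -> exists2 B, measurable B & phi i = \1_B) ->
  (\int[P]_w ((design w == x)%:R * \prod_i phi i (eps i w))%:E =
   ((2 ^ d)%:R^-1 ^+ n * \prod_i m i)%:E)%E.
  by move=> a1 a2 a3; apply: (H n) => // i; rewrite leqNgt ltn_ord.
elim: k => [|k IH] {}phi {}m mphi phi0 Em ind.
  (* All factors are indicators: this is the independence clause of the model with singletons for
     the covariates. *)
  have [B BP] := choice (fun i => (exists2P _ _).1 (ind i (leq0n i))).
  have mB i : measurable (B i) by have [] := BP i.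
  have Ephi i : phi i = \1_(B i) by have [] := BP i.
  have := indep (fun i => [set x i])%SET B mB.
  rewrite (eq_bigr (fun=> ((2 ^ d)%:R^-1)%:E)); last first.
    move=> i _; rewrite -(mX i (x i)).2; congr (P _).
    by apply/seteqP; split=> w /=; rewrite inE => /eqP.
  rewrite [X in (_ * X)%E](eq_bigr (fun i => (m i)%:E)); last first.
    move=> i _; rewrite -Em Ephi.
    transitivity (P (eps i @^-1` B i)).
      by congr (P _); apply/seteqP; split=> w /=; rewrite inE.
    rewrite (_ : (fun w => _) = (fun w => (\1_(eps i @^-1` B i) w)%:E))//.
    rewrite integral_indic ?setIT//.
    by rewrite -[X in measurable X]setTI; exact: meps.
  rewrite !prodEFin prodr_const card_ord -EFinM => <-.
  set A := [set w | _].
  have mA : measurable A.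
    rewrite (_ : A = (design @^-1` [set x]) `&` \bigcap_(i in setT) (eps i @^-1` B i)).
      apply: measurableI; first exact: measurable_design.
      apply: fin_bigcap_measurable => // i _.
      by rewrite -[X in measurable X]setTI; exact: meps.
    rewrite /A; apply/seteqP; split=> w /=.
      move=> H; split; last by move=> i _; have [_] := H i; rewrite inE.
      by apply/ffunP => i; have [+ _] := H i; rewrite inE ffunE => /eqP.
    move=> [<- H] i; split; last by rewrite inE; exact: H.
    by rewrite !inE ffunE.
  rewrite -(setIT A) -integral_indic//; apply: eq_integral => w _.
  congr EFin; rewrite indicE; apply/esym.
  have [wA|wA] := boolP (w \in A).
    move: wA; rewrite inE /A /= => wA.
    rewrite (_ : design w = x) ?eqxx ?mul1r; last first.
      by apply/ffunP => i; have [+ _] := wA i; rewrite inE ffunE => /eqP.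
    rewrite big1// => i _; rewrite Ephi indicE.
    by have [_ ->] := wA i.
  have [xw|] := eqVneq (design w) x; last by rewrite mul0r.
  have [i Bi] : exists i, eps i w \notin B i.
    suff /existsNP[i /negP] : ~ (forall i, eps i w \in B i) by exists i.
    move=> H; move/negP: wA; apply; rewrite inE => i; split; last exact: H.
    by rewrite inE -xw ffunE.
  rewrite (bigD1 i)//= Ephi indicE (negbTE Bi) mul0r mulr0//.
have [kn|nk] := ltnP k n; last first.
  by apply: IH => // i ki; have := ltn_ord i; rewrite ltnNge (leq_trans nk ki).
pose ko := Ordinal kn.
pose Z w := (design w == x)%:R * \prod_(i | i != ko) phi i (eps i w).
have mpe i : measurable_fun setT (fun w => phi i (eps i w)) by apply: measurableT_comp.
have mZ : measurable_fun setT Z.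
  rewrite /Z; apply: measurable_funM.
    rewrite (_ : (fun _ => _) = \1_(design @^-1` [set x])).
      by apply: measurable_indic; exact: measurable_design.
    apply/funext => w; rewrite indicE; congr (_%:R); congr nat_of_bool.
    by apply/idP/idP => [/eqP xw|]; rewrite inE // => ->.
  under eq_fun do rewrite -big_filter.
  by apply: measurable_prod => i _; exact: mpe.
have -> : (\int[P]_w ((design w == x)%:R * \prod_i phi i (eps i w))%:E =
   \int[P]_w (phi ko (eps ko w) * Z w)%:E)%E.
  apply: eq_integral => w _; congr EFin.
  by rewrite (bigD1 ko)//= /Z mulrCA.
pose c := (2 ^ d)%:R^-1 ^+ n * \prod_(i | i != ko) m i.
rewrite (@integral_comp_indep _ _ _ P (eps ko) Z c)//.
- by rewrite Em -EFinM /c [in RHS](bigD1 ko)//=; congr EFin; ring.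
- by move=> w; rewrite mulr_ge0// prodr_ge0.
move=> B mB.
(* With an indicator at position [ko] only the factors below [k] are arbitrary, so the induction
   hypothesis applies. *)
pose phi' i := if i == ko then \1_B else phi i.
have Pm : measurable (eps ko @^-1` B).
  by rewrite -[X in measurable X]setTI; exact: meps.
pose m' i := if i == ko then fine (P (eps ko @^-1` B)) else m i.
transitivity (\int[P]_w ((design w == x)%:R * \prod_i phi' i (eps i w))%:E)%E.
  apply: eq_integral => w _; congr EFin; rewrite [in RHS](bigD1 ko)//= /phi' eqxx.
  rewrite /Z mulrCA; congr (_ * (_ * _)); apply: eq_bigr => i.
  by move=> /negbTE ->.
rewrite (IH phi' m')//.
- rewrite (bigD1 ko)//= /m' eqxx /c.
  rewrite -[in RHS](@fineK _ (P _)); last exact: fin_num_measure.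
  rewrite -EFinM; congr EFin.
  rewrite (eq_bigr m); first by ring.
  by move=> i /negbTE ->.
- by move=> i; rewrite /phi'; case: ifP.
- by move=> i y; rewrite /phi'; case: ifP.
- move=> i; rewrite /phi' /m'; case: ifP => [/eqP ->|//].
  rewrite fineK; last exact: fin_num_measure.
  rewrite (_ : (fun w => _) = (fun w => (\1_(eps ko @^-1` B) w)%:E))//.
  by rewrite integral_indic ?setIT.
- move=> i ki; rewrite /phi'; case: ifP => [_|/negbT ik]; first by exists B.
  apply: ind; rewrite ltn_neqAle ki andbT; apply: contra ik => /eqP kE.
  by apply/eqP/val_inj.
Qed.

Lemma measurable_exp_linear (a : {ffun 'I_n -> cube d} -> 'I_n -> R) b :
  measurable_fun setT
    (fun w => expR (\sum_i a (design w) i * eps i w + b (design w))).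
Proof.
have [_ [meps _]] := model.
apply: (@measurable_fun_finite_fibers _ _ _ _ design
  (fun x w => expR (\sum_i a x i * eps i w + b x))) => x.
  exact: measurable_design.
apply: measurableT_comp => //; apply: measurable_funD => //.
by apply: measurable_sum => i; apply: measurable_funM.
Qed.

(* Conditionally on the design the noise is independent, so the exponent may be
   integrated out against the sub-Gaussian bound for each design separately. *)
Lemma expectation_exp_linear (a : {ffun 'I_n -> cube d} -> 'I_n -> R) b :
  (\int[P]_w (expR (\sum_i a (design w) i * eps i w + b (design w)))%:E <=
   ((2 ^ d)%:R^-1 ^+ n *
     \sum_x expR (b x + sigma ^+ 2 / 2 * \sum_i a x i ^+ 2))%:E)%E.
Proof.
have [_ [meps [_ [mgf _]]]] := model.
have mphi x i : measurable_fun setT (fun y : R => expR (a x i * y)).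
  by apply: measurableT_comp => //; apply: measurable_funM.
pose m x i := fine (\int[P]_w (expR (a x i * eps i w))%:E)%E.
have mE x i : (\int[P]_w (expR (a x i * eps i w))%:E = (m x i)%:E)%E.
  rewrite /m fineK// ge0_fin_numE; last first.
    by apply: integral_ge0 => w _; rewrite lee_fin expR_ge0.
  by apply: le_lt_trans (mgf i (a x i)) _; rewrite ltry.
have mle x i : m x i <= expR (sigma ^+ 2 * a x i ^+ 2 / 2).
  by rewrite -lee_fin -mE.
have m0 x i : 0 <= m x i.
  by rewrite fine_ge0//; apply: integral_ge0 => w _; rewrite lee_fin expR_ge0.
have mI x : measurable_fun setT
    (fun w => (design w == x)%:R * \prod_i expR (a x i * eps i w) : R).
  apply: (@measurable_fun_finite_fibers _ _ _ _ design
    (fun z w => (z == x)%:R * \prod_i expR (a x i * eps i w))) => z.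
    exact: measurable_design.
  apply: measurable_funM => //; apply: measurable_prod => i _.
  by apply: measurableT_comp => //; apply: measurable_funM.
have -> : (\int[P]_w (expR (\sum_i a (design w) i * eps i w + b (design w)))%:E =
  \int[P]_w (\sum_x (expR (b x) *
     ((design w == x)%:R * \prod_i expR (a x i * eps i w)))%:E))%E.
  apply: eq_integral => w _.
  rewrite sumEFin; congr EFin.
  rewrite (bigD1 (design w))//= [X in _ = _ + X]big1 => [|z]; last first.
    by rewrite eq_sym => /negbTE ->; rewrite mul0r mulr0.
  by rewrite eqxx mul1r addr0 expRD expR_sum mulrC.
rewrite ge0_integral_sum//; last 2 first.
- by move=> x; apply/measurable_EFinP; apply: measurable_funM.
- by move=> x w _; rewrite lee_fin !mulr_ge0 ?expR_ge0// prodr_ge0// => i _; exact: expR_ge0.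
rewrite (eq_bigr (fun x => (expR (b x) * ((2 ^ d)%:R^-1 ^+ n * \prod_i m x i))%:E));
  last first.
  move=> x _; under eq_integral do rewrite EFinM.
  rewrite ge0_integralZl_EFin ?expR_ge0//; last 2 first.
  - by move=> w _; rewrite lee_fin mulr_ge0// prodr_ge0// => i _; exact: expR_ge0.
  - exact/measurable_EFinP.
  rewrite (integral_design_prod x (phi := fun i y => expR (a x i * y)) (m := m x))//.
rewrite sumEFin lee_fin mulr_sumr; apply: ler_sum => x _.
rewrite mulrCA ler_wpM2l ?exprn_ge0 ?invr_ge0//.
rewrite expRD ler_wpM2l ?expR_ge0//.
rewrite mulr_sumr expR_sum; apply: ler_prod => i _.
by rewrite m0/=; apply: le_trans (mle x i) _; rewrite ler_expR; lra.
Qed.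
End Model.

(** * Measurability of the CART risk *)

Lemma measurable_bool_vector (dT : measure_display) (T : measurableType dT)
  (I : finType) (b : I -> T -> bool) (r : {ffun I -> bool}) :
  (forall i, measurable_fun setT (b i)) ->
  measurable ((fun w => [ffun i => b i w]) @^-1` [set r]).
Proof.
move=> mb.
rewrite (_ : _ @^-1` _ = \bigcap_(i in setT) (b i @^-1` [set r i])); last first.
  apply/seteqP; split=> w /=.
    by move=> <- i _; rewrite /= ffunE.
  by move=> H; apply/ffunP => i; rewrite ffunE; exact: H.
apply: fin_bigcap_measurable => // i _.
by rewrite -[X in measurable X]setTI; exact: mb.
Qed.

Lemma measurable_fun_sum_cond (R : realType) (dT : measure_display) (T : measurableType dT)
  (I : finType) (A : pred I) (h : I -> T -> R) :
  (forall i, measurable_fun setT (h i)) ->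
  measurable_fun setT (fun w => \sum_(i | A i) h i w).
Proof.
by move=> mh; under eq_fun do rewrite -big_filter; exact: measurable_sum.
Qed.

Section MeasurableCart.
Variables (R : realType) (dT : measure_display) (T : measurableType dT).
Variables (d n : nat) (Xs : 'I_n -> cube d) (Y : 'I_n -> T -> R) (gamma : R).
Hypothesis mY : forall i, measurable_fun setT (Y i).

Let Yw w := fun i => Y i w.

Lemma measurable_mean_resp C : measurable_fun setT (fun w => mean_resp Xs (Yw w) C).
Proof. by apply: measurable_funM => //; exact: measurable_fun_sum_cond. Qed.

Lemma measurable_impurity C : measurable_fun setT (fun w => impurity Xs (Yw w) C).
Proof.
apply: measurable_funM => //; apply: measurable_fun_sum_cond => i.
by apply: measurable_funX; apply: measurable_funB; [exact: mY|exact: measurable_mean_resp].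
Qed.

Lemma measurable_imp_decrease k C :
  measurable_fun setT (fun w => imp_decrease Xs (Yw w) k C).
Proof.
apply: measurable_funB; [apply: measurable_funB|]; first exact: measurable_impurity.
  by apply: measurable_funM => //; exact: measurable_impurity.
by apply: measurable_funM => //; exact: measurable_impurity.
Qed.

(** The growth depends on the responses only through finite families of comparisons: which split
    wins and whether it passes the threshold. Once these are fixed, the next step is a fixed mean or
    a fixed recursive call. *)
Lemma measurable_cart_go fuel C x :
  measurable_fun setT (fun w => cart_go Xs (Yw w) gamma fuel C x).
Proof.
elim: fuel C => [|fuel IH] C /=; first exact: measurable_mean_resp.
pose cmp w := [ffun p : 'I_d * 'I_d =>
  imp_decrease Xs (Yw w) p.2 C <= imp_decrease Xs (Yw w) p.1 C].
pose stop w := [ffun k : 'I_d =>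
  (Ncell Xs C)%:R / n%:R * imp_decrease Xs (Yw w) k C < gamma].
(* [pck] replays [best_split] on the recorded comparisons. *)
pose pck (r : {ffun 'I_d * 'I_d -> bool}) := [pick k | (k \notin Jcell C) &&
     [forall k', (k' \notin Jcell C) ==> r (k, k')]].
rewrite (_ : (fun w => _) = (fun w => match pck (cmp w) with
    | None => mean_resp Xs (Yw w) C
    | Some k => if stop w k then mean_resp Xs (Yw w) C
                else cart_go Xs (Yw w) gamma fuel (split_cell C k (x k)) x end));
  last first.
  apply/funext => w.
  rewrite (_ : best_split _ _ _ = pck (cmp w)); last first.
    apply: eq_pick => k /=; congr (_ && _); apply: eq_forallb => k'.
    by rewrite ffunE.
  by case: (pck _) => // k; rewrite ffunE.
apply: (@measurable_fun_finite_fibers _ _ _ _ cmp (fun r w => match pck r with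
    | None => mean_resp Xs (Yw w) C
    | Some k => if stop w k then mean_resp Xs (Yw w) C
                else cart_go Xs (Yw w) gamma fuel (split_cell C k (x k)) x end)).
  move=> r; apply: measurable_bool_vector => p.
  by apply: measurable_fun_ler; exact: measurable_imp_decrease.
move=> r; case: (pck r) => [k|] /=; last exact: measurable_mean_resp.
apply: (@measurable_fun_finite_fibers _ _ _ _ stop (fun r w =>
  if r k then mean_resp Xs (Yw w) C
  else cart_go Xs (Yw w) gamma fuel (split_cell C k (x k)) x)).
  move=> b; apply: measurable_bool_vector => j.
  apply: measurable_fun_ltr => //; apply: measurable_funM => //.
  exact: measurable_imp_decrease.
by move=> b; case: (b k); [exact: measurable_mean_resp|exact: IH].
Qed.
End MeasurableCart.

Lemma measurable_cart_risk (R : realType) (dT : measure_display) (T : measurableType dT)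
  (P : probability T R) (d s n : nat) (f0 : cube s -> R) (e : 'I_s -> 'I_d)
  (gamma sigma : R) (X : 'I_n -> T -> cube d) (eps : 'I_n -> T -> R) :
  cart_model P X eps sigma -> measurable_fun setT (cart_risk f0 e gamma X eps).
Proof.
move=> model; have [_ [meps _]] := model.
rewrite (_ : cart_risk _ _ _ _ _ = (fun w => risk (cart (design X w)
    (fun i => fstar f0 e (design X w i) + eps i w) gamma) (fstar f0 e))); last first.
  apply/funext => w; rewrite /cart_risk.
  have E : (fun i => X i w) = design X w by apply/funext => i; rewrite ffunE.
  by rewrite -!E.
apply: (@measurable_fun_finite_fibers _ _ _ _ (design X) (fun x w => risk (cart x
    (fun i => fstar f0 e (x i) + eps i w) gamma) (fstar f0 e))) => x.
  exact: measurable_design model _.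
apply: measurable_funM => //; apply: measurable_fun_sum_cond => z.
apply: measurable_funX; apply: measurable_funB => //.
apply: (@measurable_cart_go _ _ _ _ _ x (fun i w => fstar f0 e (x i) + eps i w)) => i.
exact: measurable_funD.
Qed.

(** * Cells and their lifts *)

(* The set comprehensions under [#|_|] in [Ncell] and [cell_avg] are classical sets. *)
Lemma card_mkset (I : finType) (p : pred I) :
  #|[set i | p i]%classic| = #|[set i | p i]%SET|.
Proof.
by apply: eq_card => i; rewrite inE; apply/idP/idP => [/set_mem//|pi]; exact: mem_set.
Qed.

Lemma in_split_cell d (C : cell d) k b x : k \notin Jcell C ->
  in_cell (split_cell C k b) x = in_cell C x && (x k == b).
Proof.
rewrite inE negbK => /eqP Ck; apply/forallP/andP => [H|[/forallP H /eqP xk] j].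
  split; last by have := H k; rewrite ffunE eqxx.
  by apply/forallP => j; have := H j; rewrite ffunE; case: eqP => [->|//]; rewrite Ck.
by rewrite ffunE; case: eqP => [->|_]; [exact/eqP|exact: H].
Qed.

Lemma Jcell_split d (C : cell d) k b : Jcell (split_cell C k b) = k |: Jcell C.
Proof. by apply/setP => j; rewrite !inE ffunE; case: (j =P k). Qed.

Lemma card_Jcell_split d (C : cell d) k b : k \notin Jcell C ->
  #|Jcell (split_cell C k b)| = #|Jcell C|.+1.
Proof. by move=> kC; rewrite Jcell_split cardsU1 kC. Qed.

(** The indicator of a cell is a product over coordinates, so the sum over the cube factors: a fixed
    coordinate contributes 1 and a free one 2. The product form avoids division of natural
    numbers. *)
Lemma card_cell d (C : cell d) :
  (#|[set x | in_cell C x]%SET| * 2 ^ #|Jcell C|)%N = (2 ^ d)%N.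
Proof.
have -> : #|[set x | in_cell C x]%SET| = (\prod_j (if C j is Some _ then 1 else 2))%N.
  rewrite -sum1_card (eq_bigl (in_cell C)) => [|x]; last by rewrite inE.
  transitivity (\sum_(x : cube d) \prod_j
      (if C j is Some b then (x j == b : nat) else 1))%N.
    rewrite big_mkcond; apply: eq_bigr => x _.
    have [H|] := boolP (in_cell C x).
      rewrite big1// => j _; have /forallP/(_ j) := H.
      by case: (C j) => // b ->.
    rewrite negb_forall => /existsP[j].
    by rewrite (bigD1 j)//=; case: (C j) => // b /negbTE ->; rewrite mul0n.
  rewrite -(bigA_distr_bigA (fun j (b : bool) =>
    if C j is Some b' then (b == b' : nat) else 1%N)).
  apply: eq_bigr => j _; rewrite big_bool.
  by case: (C j) => // -[].
rewrite -sum1_card expn_sum [X in (_ * X)%N]big_mkcond -big_split /=.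
rewrite -[d in RHS]card_ord -prod_nat_const; apply: eq_bigr => j _.
by rewrite inE; case: (C j).
Qed.

Lemma card_split_cell d (C : cell d) k b : k \notin Jcell C ->
  (#|[set x | in_cell (split_cell C k b) x]%SET| * 2)%N =
  #|[set x | in_cell C x]%SET|.
Proof.
move=> kC; apply/eqP; rewrite -(eqn_pmul2r (expn_gt0 2 #|Jcell C|)) card_cell.
by rewrite -mulnA -expnS -(card_Jcell_split b kC) card_cell.
Qed.

Lemma card_cell_gt0 d (C : cell d) : (0 < #|[set x | in_cell C x]%SET|)%N.
Proof.
have : (0 < 2 ^ d)%N by rewrite expn_gt0.
by rewrite -(card_cell C) muln_gt0 => /andP[].
Qed.

Section Lift.
Variables (d s : nat) (e : 'I_s -> 'I_d).
Hypothesis e_inj : injective e.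

Definition restr (x : cube d) : cube s := [ffun k => x (e k)].

Definition extend (z : cube s) : cube d :=
  [ffun j => if [pick k | e k == j] is Some k then z k else false].

(** Off the bad events CART visits only such cells, so union bounds run over [3^s] cells and not
    over [3^d]. *)
Definition lift_cell (c : cell s) : cell d :=
  [ffun j => if [pick k | e k == j] is Some k then c k else None].

Lemma pick_e k : [pick k' | e k' == e k] = Some k.
Proof. by case: pickP => [k' /eqP/e_inj ->//|/(_ k)]; rewrite eqxx. Qed.

Lemma pick_Sstar j : j \notin Sstar e -> [pick k' | e k' == j] = None.
Proof.
move=> jS; case: pickP => // k /eqP ek; case/negP: jS; apply/imsetP.
by exists k.
Qed.

Lemma restr_extend z : restr (extend z) = z.
Proof. by apply/ffunP => k; rewrite !ffunE pick_e. Qed.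

Lemma lift_cellE c k : lift_cell c (e k) = c k.
Proof. by rewrite ffunE pick_e. Qed.

Lemma lift_cell_out c j : j \notin Sstar e -> lift_cell c j = None.
Proof. by move=> jS; rewrite ffunE pick_Sstar. Qed.

Lemma in_lift_cell c x : in_cell (lift_cell c) x = in_cell c (restr x).
Proof.
apply/forallP/forallP => [H k|H j].
  by have := H (e k); rewrite lift_cellE ffunE.
have [/imsetP[k _ ->]|jS] := boolP (j \in Sstar e).
  by rewrite lift_cellE; have := H k; rewrite ffunE.
by rewrite lift_cell_out.
Qed.

Lemma Jcell_lift c : Jcell (lift_cell c) = [set e k | k in Jcell c]%SET.
Proof.
apply/setP => j; rewrite inE.
have [/imsetP[k _ ->]|jS] := boolP (j \in Sstar e).
  by rewrite lift_cellE mem_imset// inE.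
rewrite lift_cell_out// eqxx; apply/esym/negP => /imsetP[k _ jk].
by case/negP: jS; apply/imsetP; exists k.
Qed.

Lemma card_Jcell_lift c : #|Jcell (lift_cell c)| = #|Jcell c|.
Proof. by rewrite Jcell_lift card_imset. Qed.

Lemma mem_Jcell_lift c k : (e k \in Jcell (lift_cell c)) = (k \in Jcell c).
Proof. by rewrite Jcell_lift mem_imset. Qed.

Lemma Jcell_lift_Sstar c : Jcell (lift_cell c) :&: Sstar e = Jcell (lift_cell c).
Proof.
apply/finset.setIidPl; rewrite Jcell_lift; apply/fintype.subsetP => j /imsetP[k _ ->].
by apply/imsetP; exists k.
Qed.

Lemma lift_root : lift_cell (root_cell s) = root_cell d.
Proof. by apply/ffunP => j; rewrite !ffunE; case: pickP => // k _; rewrite ffunE. Qed.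

Lemma lift_split c k b : split_cell (lift_cell c) (e k) b = lift_cell (split_cell c k b).
Proof.
apply/ffunP => j; rewrite ffunE.
have [->|jk] := eqVneq j (e k); first by rewrite lift_cellE ffunE eqxx.
have [/imsetP[k' _ E]|jS] := boolP (j \in Sstar e); last by rewrite !lift_cell_out.
rewrite E !lift_cellE ffunE; case: eqP => // k'k; by rewrite E k'k eqxx in jk.
Qed.
End Lift.

(** * Contrasts *)

Section Contrast.
Variables (R : realType) (d n : nat) (Xs : 'I_n -> cube d).

Local Notation N C := ((Ncell Xs C)%:R : R).

Lemma NcellE C : N C = \sum_(i | in_cell C (Xs i)) 1.
Proof.
rewrite /Ncell card_mkset -sum1_card (eq_bigl (fun i => in_cell C (Xs i))) => [|i].
  by rewrite natr_sum.
by rewrite inE.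
Qed.

Lemma sum_split_cell C k (F : 'I_n -> R) : k \notin Jcell C ->
  \sum_(i | in_cell C (Xs i)) F i =
  \sum_(i | in_cell (split_cell C k true) (Xs i)) F i +
  \sum_(i | in_cell (split_cell C k false) (Xs i)) F i.
Proof.
move=> kC; rewrite (bigID (fun i => Xs i k))/=; congr (_ + _); apply: eq_bigl => i;
  by rewrite in_split_cell//; case: (Xs i k).
Qed.

Lemma Ncell_split C k : k \notin Jcell C ->
  N C = N (split_cell C k true) + N (split_cell C k false).
Proof. by move=> kC; rewrite !NcellE (sum_split_cell _ kC). Qed.

Lemma Ncell_eq0_sum C (F : 'I_n -> R) : N C = 0 -> \sum_(i | in_cell C (Xs i)) F i = 0.
Proof.
move=> /eqP; rewrite pnatr_eq0 /Ncell card_mkset cards_eq0 => /eqP C0; rewrite big1// => i Ci.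
by move/finset.setP/(_ i): C0; rewrite finset.in_set0 inE Ci.
Qed.

(** Multiplying by the count keeps the expansion of the sum of squares valid on an empty cell, where
    every term is 0 since [x / 0 = 0]. *)
Lemma Ncell_impurity (Y : 'I_n -> R) C : N C * impurity Xs Y C =
  \sum_(i | in_cell C (Xs i)) Y i ^+ 2 - (\sum_(i | in_cell C (Xs i)) Y i) ^+ 2 / N C.
Proof.
have [N0|N0] := eqVneq (N C) 0.
  by rewrite N0 mul0r !(Ncell_eq0_sum _ N0) expr2 !mul0r subr0.
rewrite /impurity mulrA divff// mul1r.
set m := mean_resp Xs Y C.
have Tm : \sum_(i | in_cell C (Xs i)) Y i = N C * m.
  by rewrite /m /mean_resp mulrA divff// mul1r.
rewrite Tm (eq_bigr (fun i => Y i ^+ 2 + (- (2 * m) * Y i + m ^+ 2 * 1))); last first.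
  by move=> i _; ring.
rewrite big_split/= big_split/= -!mulr_sumr Tm -NcellE; field.
exact: N0.
Qed.

(** The square root of the factor [N+ N- / N] of the between-group sum of squares. It normalises the
    contrast and vanishes as soon as a child is empty. *)
Definition contrast_scale C k : R :=
  Num.sqrt (N (split_cell C k true) * N (split_cell C k false) / N C).

Definition contrast C k i : R :=
  if in_cell C (Xs i) then
    if Xs i k then contrast_scale C k / N (split_cell C k true)
    else - (contrast_scale C k / N (split_cell C k false))
  else 0.

Lemma sum_contrast C k (F : 'I_n -> R) : k \notin Jcell C ->
  \sum_i contrast C k i * F i =
  contrast_scale C k / N (split_cell C k true) *
    \sum_(i | in_cell (split_cell C k true) (Xs i)) F i -
  contrast_scale C k / N (split_cell C k false) *
    \sum_(i | in_cell (split_cell C k false) (Xs i)) F i.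
Proof.
move=> kC; transitivity (\sum_(i | in_cell C (Xs i)) contrast C k i * F i).
  rewrite [RHS]big_mkcond; apply: eq_bigr => i _; rewrite /contrast.
  by case: ifP; rewrite ?mul0r.
rewrite (sum_split_cell _ kC) !mulr_sumr -sumrN; congr (_ + _); apply: eq_bigr => i;
  by rewrite in_split_cell// /contrast => /andP[-> /eqP ->]; rewrite ?mulNr.
Qed.

Lemma contrast_scale_sqr C k : contrast_scale C k ^+ 2 =
  N (split_cell C k true) * N (split_cell C k false) / N C.
Proof. by rewrite sqr_sqrtr// divr_ge0// mulr_ge0. Qed.

Lemma contrast_scale_eq0 C k b : N (split_cell C k b) = 0 -> contrast_scale C k = 0.
Proof. by case: b => E; rewrite /contrast_scale E ?(mul0r, mulr0, sqrtr0). Qed.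

(** Isolates the signal in a contrast: the child averages of the target form a function of the split
    coordinate alone. *)
Lemma sum_contrast_sign C k (g : bool -> R) : k \notin Jcell C ->
  \sum_i contrast C k i * g (Xs i k) = contrast_scale C k * (g true - g false).
Proof.
move=> kC; rewrite sum_contrast//.
have E b : \sum_(i | in_cell (split_cell C k b) (Xs i)) g (Xs i k) = N (split_cell C k b) * g b.
  rewrite NcellE mulr_suml; apply: eq_bigr => i.
  by rewrite in_split_cell// => /andP[_ /eqP ->]; rewrite mul1r.
rewrite !E.
have D b : contrast_scale C k / N (split_cell C k b) * (N (split_cell C k b) * g b) =
    contrast_scale C k * g b.
  have [N0|N0] := eqVneq (N (split_cell C k b)) 0.
    by rewrite (contrast_scale_eq0 N0) !mul0r.
  by rewrite mulrA divfK.
by rewrite !D mulrBr.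
Qed.

(** With two nonempty children the sum is [scale^2 (1/N+ + 1/N-) = 1]; with an empty child the
    contrast is zero, whence the inequality. *)
Lemma sum_contrast_sqr C k : k \notin Jcell C -> \sum_i contrast C k i ^+ 2 <= 1.
Proof.
move=> kC; under eq_bigr do rewrite expr2.
rewrite sum_contrast//.
have E b : \sum_(i | in_cell (split_cell C k b) (Xs i)) contrast C k i =
    (if b then 1 else -1) * (N (split_cell C k b) *
      (contrast_scale C k / N (split_cell C k b))).
  rewrite NcellE mulr_suml mulr_sumr; apply: eq_bigr => i.
  rewrite in_split_cell// /contrast => /andP[-> /eqP ->].
  by rewrite -NcellE; case: b; ring.
rewrite !E; have := Ncell_split kC; have := contrast_scale_sqr C k.
set S := contrast_scale C k; set Np := N _; set Nm := N _; set NN := N C.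
move=> S2 NE.
have [p0|p0] := eqVneq Np 0; first by rewrite (contrast_scale_eq0 p0 : S = 0) !mul0r subr0.
have [m0|m0] := eqVneq Nm 0; first by rewrite (contrast_scale_eq0 m0 : S = 0) !mul0r subr0.
have NN0 : NN != 0.
  by rewrite NE paddr_eq0 ?ler0n// negb_and p0.
rewrite (_ : _ - _ = S ^+ 2 * (Np^-1 + Nm^-1)); last by field; rewrite p0 m0.
by rewrite S2 NE le_eqVlt; apply/orP; left; apply/eqP; field; rewrite p0 m0 -NE NN0.
Qed.

(** Decomposition of the total sum of squares into within-group and between-group parts. It turns
    the impurity decrease into the square of a linear form in the responses, to which exponential
    moments apply. *)
Lemma imp_decrease_contrast (Y : 'I_n -> R) C k : k \notin Jcell C ->
  N C * imp_decrease Xs Y k C = (\sum_i contrast C k i * Y i) ^+ 2.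
Proof.
move=> kC; rewrite sum_contrast//.
have NE := Ncell_split kC; have S2 := contrast_scale_sqr C k.
have [N0|N0] := eqVneq (N C) 0.
  rewrite N0 mul0r; move: NE => /esym; rewrite N0 => /eqP.
  by rewrite paddr_eq0// => /andP[/eqP p0 _]; rewrite (contrast_scale_eq0 p0) !mul0r subr0 expr2 mul0r.
have -> : N C * imp_decrease Xs Y k C = N C * impurity Xs Y C -
    N (split_cell C k true) * impurity Xs Y (split_cell C k true) -
    N (split_cell C k false) * impurity Xs Y (split_cell C k false).
  by rewrite /imp_decrease; field.
rewrite !Ncell_impurity !(sum_split_cell _ kC).
have z0 b : N (split_cell C k b) = 0 ->
    \sum_(i | in_cell (split_cell C k b) (Xs i)) Y i = 0.
  exact: Ncell_eq0_sum.
move: NE S2 N0 (z0 true) (z0 false) (@contrast_scale_eq0 C k true) (@contrast_scale_eq0 C k false).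
move: (contrast_scale C k) (N _) (N _) (N C) (\sum_(i | _) Y i) (\sum_(i | _) Y i)
  (\sum_(i | _) Y i ^+ 2) (\sum_(i | _) Y i ^+ 2).
move=> S Nm Np NN Tm Tp Qm Qp NE S2 N0 zp zm sp sm.
have [p0|p0] := eqVneq Np 0.
  rewrite (sp p0) (zp p0) !mul0r subr0 NE p0 !add0r.
  by rewrite ?expr0n /= ?mul0r; ring.
have [m0|m0] := eqVneq Nm 0.
  rewrite (sm m0) (zm m0) !mul0r subr0 NE m0 !addr0.
  by rewrite ?expr0n /= ?mul0r; ring.
rewrite (_ : (_ - _) ^+ 2 = S ^+ 2 * (Tp / Np - Tm / Nm) ^+ 2); last by field; rewrite p0 m0.
by rewrite S2; move: N0; rewrite NE => N0; field; rewrite p0 m0 N0.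
Qed.
End Contrast.

(** * Cell averages and SMSP *)

Section CellAverages.
Variables (R : realType) (d : nat).
Implicit Types (C : cell d) (f : cube d -> R).

Lemma supnorm_ge f x : `|f x| <= supnorm f.
Proof. by rewrite /supnorm (bigD1 x)//= le_max lexx. Qed.

Lemma cell_avgE C f : #|[set x | in_cell C x]%SET|%:R * cell_avg C f = \sum_(x | in_cell C x) f x.
Proof.
rewrite /cell_avg card_mkset mulrA divff ?mul1r//.
by rewrite pnatr_eq0 -lt0n card_cell_gt0.
Qed.

Lemma norm_cell_avg_le C f (M : R) : (forall x, `|f x| <= M) -> `|cell_avg C f| <= M.
Proof.
move=> fM; have c0 : 0 < #|[set x | in_cell C x]%SET|%:R :> R.
  by rewrite ltr0n card_cell_gt0.
rewrite -(ler_pM2l c0) -{1}(gtr0_norm c0) -normrM cell_avgE.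
apply: le_trans (ler_norm_sum _ _ _) _.
apply: le_trans (ler_sum _ (fun x _ => fM x)) _.
rewrite sumr_const mulr_natl.
by rewrite (eq_card (B := [set x | in_cell C x]%SET))// => x; rewrite inE.
Qed.

Lemma sum_cell_split C k f : k \notin Jcell C ->
  \sum_(x | in_cell C x) f x =
  \sum_(x | in_cell (split_cell C k true) x) f x +
  \sum_(x | in_cell (split_cell C k false) x) f x.
Proof.
move=> kC; rewrite (bigID (fun x : cube d => x k))/=; congr (_ + _); apply: eq_bigl => x;
  by rewrite in_split_cell//; case: (x k).
Qed.

Lemma cell_avg_split C k f : k \notin Jcell C ->
  cell_avg C f = (cell_avg (split_cell C k true) f + cell_avg (split_cell C k false) f) / 2.
Proof.
move=> kC; have c0 : #|[set x | in_cell C x]%SET|%:R != 0 :> R.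
  by rewrite pnatr_eq0 -lt0n card_cell_gt0.
apply: (mulfI c0); rewrite cell_avgE (sum_cell_split _ kC) -!cell_avgE.
rewrite -(card_split_cell true kC) natrM.
have -> : #|[set x | in_cell (split_cell C k false) x]%SET| =
    #|[set x | in_cell (split_cell C k true) x]%SET|.
  apply/eqP; rewrite -(eqn_pmul2r (isT : 0 < 2)%N).
  by rewrite !card_split_cell.
by field.
Qed.

Lemma eq_cell_avg C f g : (forall x, in_cell C x -> f x = g x) -> cell_avg C f = cell_avg C g.
Proof. by move=> fg; rewrite /cell_avg; congr (_ * _); apply: eq_bigr. Qed.

Lemma cell_avgM C f (a : R) : cell_avg C (fun x => a * f x) = a * cell_avg C f.
Proof. by rewrite /cell_avg -mulr_sumr mulrCA. Qed.

Lemma cell_avg_cst C (a : R) : cell_avg C (fun=> a) = a.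
Proof.
have c0 : #|[set x | in_cell C x]%SET|%:R != 0 :> R.
  by rewrite pnatr_eq0 -lt0n card_cell_gt0.
apply: (mulfI c0); rewrite cell_avgE sumr_const mulr_natl.
by rewrite (eq_card (B := [set x | in_cell C x]%SET))// => x; rewrite inE.
Qed.

(** Inside [C] the free coordinate [k] is a fair sign, so its mean vanishes and the covariance
    compares the two halves. *)
Lemma cell_cov_split C k f : k \notin Jcell C ->
  cell_cov f k C =
  (cell_avg (split_cell C k true) f - cell_avg (split_cell C k false) f) / 2.
Proof.
move=> kC.
have spinE b (g : cube d -> R) : cell_avg (split_cell C k b) (fun x => g x * spin (x k)) =
    spin b * cell_avg (split_cell C k b) g.
  rewrite -cell_avgM; apply: eq_cell_avg => x.
  by rewrite in_split_cell// => /andP[_ /eqP ->]; rewrite mulrC.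
rewrite /cell_cov (cell_avg_split (fun x => f x * spin (x k)) kC).
rewrite [X in _ - _ * X](cell_avg_split _ kC) !spinE.
have sE b : cell_avg (split_cell C k b) (fun x => spin (x k)) = spin b :> R.
  rewrite -[RHS]mulr1 -(cell_avg_cst (split_cell C k b) 1) -spinE.
  by apply: eq_cell_avg => x _; rewrite mul1r.
by rewrite !sE /spin; lra.
Qed.
End CellAverages.

Section Structure.
Variables (R : realType) (d s : nat) (f0 : cube s -> R) (e : 'I_s -> 'I_d) (lam : R).
Hypothesis e_inj : injective e.
Hypothesis smsp : SMSP (fstar f0 e) (Sstar e) lam.
Hypothesis lam0 : 0 < lam.
Local Notation f := (fstar f0 e).
Local Notation M := (supnorm f).

Definition nonconst (c : cell s) : bool :=
  [exists z, exists z', [&& in_cell c z, in_cell c z' & f0 z != f0 z']].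

Lemma constP c z z' : ~~ nonconst c -> in_cell c z -> in_cell c z' -> f0 z = f0 z'.
Proof.
move=> H cz cz'; apply/eqP; apply: contraR H => zz'.
by apply/existsP; exists z; apply/existsP; exists z'; rewrite cz cz'.
Qed.

(** Flipping the irrelevant coordinate [k] maps one child onto the other and leaves the target
    unchanged. *)
Lemma cell_avg_split_out c k : k \notin Sstar e ->
  cell_avg (split_cell (lift_cell e c) k true) f =
  cell_avg (split_cell (lift_cell e c) k false) f.
Proof.
move=> kS.
have kJ : k \notin Jcell (lift_cell e c) by rewrite inE lift_cell_out.
pose flip (x : cube d) : cube d := [ffun j => if j == k then ~~ x j else x j].
have flipK : involutive flip.
  by move=> x; apply/ffunP => j; rewrite !ffunE; case: eqP => //; rewrite negbK.
have rflip x : restr e (flip x) = restr e x.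
  apply/ffunP => j; rewrite !ffunE; case: eqP => // ejk.
  by case/negP: kS; apply/imsetP; exists j.
have c0 : #|[set x | in_cell (split_cell (lift_cell e c) k true) x]%SET|%:R != 0 :> R.
  by rewrite pnatr_eq0 -lt0n card_cell_gt0.
apply: (mulfI c0).
have E : #|[set x | in_cell (split_cell (lift_cell e c) k true) x]%SET| =
    #|[set x | in_cell (split_cell (lift_cell e c) k false) x]%SET|.
  apply/eqP; rewrite -(eqn_pmul2r (isT : 0 < 2)%N).
  by rewrite !card_split_cell.
rewrite cell_avgE E cell_avgE (reindex_inj (inv_inj flipK)) /=.
apply: eq_big => [x|x _].
  by rewrite !in_split_cell// !in_lift_cell// rflip ffunE eqxx; case: (x k).
by rewrite /fstar; congr f0; exact: rflip.
Qed.

(** A coordinate outside [Sstar] has zero covariance with the target, which [0 < lam] excludes; the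
    coordinate supplied by SMSP is therefore relevant. *)
Lemma smsp_split c : nonconst c -> exists k, k \notin Jcell c /\
  lam * (2 ^ #|Jcell c|)%:R <=
    ((cell_avg (split_cell (lift_cell e c) (e k) true) f -
      cell_avg (split_cell (lift_cell e c) (e k) false) f) / 2) ^+ 2.
Proof.
move=> /existsP[z /existsP[z' /and3P[cz cz' zz']]].
have [|k [kJ]] := smsp (C := lift_cell e c).
  exists (extend e z), (extend e z').
  have rE := restr_extend e_inj.
  rewrite !in_lift_cell// !rE; split=> //.
  by rewrite /fstar -!/(restr e _) !rE.
rewrite Jcell_lift_Sstar// card_Jcell_lift// cell_cov_split//.
rewrite ler_pdivlMr ?ltr0n ?expn_gt0// => H.
have [/imsetP[k' _ kk']|kS] := boolP (k \in Sstar e); last first.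
  move: H; rewrite cell_avg_split_out// subrr mul0r expr0n/=.
  have p0 : 0 < lam * (2 ^ #|Jcell c|)%:R by rewrite mulr_gt0// ltr0n expn_gt0.
  by move=> /(lt_le_trans p0); rewrite ltxx.
by exists k'; rewrite -kk'; split=> //; rewrite -(mem_Jcell_lift e_inj) -kk'.
Qed.

(** Half the difference of two averages is at most the sup norm. This limits the depth of
    nonconstant cells, and so keeps their expected counts large. *)
Lemma lam_le_supnorm c : nonconst c -> lam * (2 ^ #|Jcell c|)%:R <= M ^+ 2.
Proof.
move=> /smsp_split[k [_ /le_trans]]; apply.
have aM b := norm_cell_avg_le (split_cell (lift_cell e c) (e k) b) (supnorm_ge f).
have := aM true; have := aM false; rewrite !ler_norml => /andP[a1 a2] /andP[b1 b2].
by rewrite -[leLHS]real_normK ?num_real// lerXn2r ?nnegrE ?normr_ge0//;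
  [exact: le_trans (supnorm_ge f [ffun=> true])|rewrite ler_norml; apply/andP; split; lra].
Qed.
End Structure.

(** * CART on a good sample *)

(** Weighted Cauchy-Schwarz, by expanding the nonnegative sum of [N i (S i / N i - SS / NN)^2].
    Indices with [N i = 0] contribute nothing to either side. *)
Lemma sum_sqr_div_le (R : realType) (I : finType) (A : pred I) (S N : I -> R) :
  (forall i, 0 <= N i) -> (forall i, N i = 0 -> S i = 0) ->
  (\sum_(i | A i) S i) ^+ 2 <= (\sum_(i | A i) N i) * \sum_(i | A i) S i ^+ 2 / N i.
Proof.
move=> N0 NS; have [n0|n0] := eqVneq (\sum_(i | A i) N i) 0.
  rewrite big1 ?expr0n ?n0 ?mul0r// => i Ai; apply: NS.
  by apply/eqP; move/eqP: n0; rewrite psumr_eq0// => /allP/(_ i (mem_index_enum i)); rewrite Ai.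
set NN := \sum_(i | A i) N i in n0 *; set SS := \sum_(i | A i) S i.
have NN0 : 0 < NN by rewrite lt0r n0 sumr_ge0.
have : 0 <= \sum_(i | A i) N i * (S i / N i - SS / NN) ^+ 2.
  by apply: sumr_ge0 => i _; rewrite mulr_ge0// sqr_ge0.
rewrite (eq_bigr (fun i => S i ^+ 2 / N i + (- (2 * (SS / NN)) * S i + (SS / NN) ^+ 2 * N i))).
  rewrite big_split/= big_split/= -!mulr_sumr -/SS -/NN => H.
  suff -> : NN * (\sum_(i | A i) S i ^+ 2 / N i) = SS ^+ 2 + NN * (\sum_(i | A i) S i ^+ 2 / N i +
    (- (2 * (SS / NN)) * SS + (SS / NN) ^+ 2 * NN)) by rewrite lerDl mulr_ge0// ltW.
  by field.
move=> i _; have [Ni|Ni] := eqVneq (N i) 0; last by field; rewrite n0 Ni.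
by rewrite (NS _ Ni) Ni; ring.
Qed.

Lemma best_split_some (R : realType) (d n : nat) (Xs : 'I_n -> cube d) (Y : 'I_n -> R) C k :
  best_split Xs Y C = Some k -> k \notin Jcell C.
Proof.
rewrite /best_split.
by case: (@pickP _ (fun k : 'I_d => _)) => [k' /andP[kJ _] [<-]|].
Qed.

Lemma best_split_max (R : realType) (d n : nat) (Xs : 'I_n -> cube d) (Y : 'I_n -> R) C k0 :
  k0 \notin Jcell C ->
  exists2 k, best_split Xs Y C = Some k & imp_decrease Xs Y k0 C <= imp_decrease Xs Y k C.
Proof.
move=> k0J; rewrite /best_split.
case: (@pickP _ (fun k : 'I_d => _)) => [k /andP[kJ /forallP H]|H].
  by exists k => //; have := H k0; rewrite k0J.
have [k kJ kmax] := @Order.TotalTheory.arg_maxP _ R _ k0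
  (fun k => k \notin Jcell C) (fun k => imp_decrease Xs Y k C) k0J.
have := H k; rewrite /= kJ /= => /negP; case.
by apply/forallP => k'; apply/implyP => k'J; exact: kmax.
Qed.

Section Deterministic.
Variables (R : realType) (d s n : nat) (f0 : cube s -> R) (e : 'I_s -> 'I_d).
Variables (lam tau gamma : R) (Xs : 'I_n -> cube d) (eps : 'I_n -> R).
Hypothesis e_inj : injective e.
Hypothesis smsp : SMSP (fstar f0 e) (Sstar e) lam.
Hypothesis lam0 : 0 < lam.
Hypothesis n0 : (0 < n)%N.
Local Notation f := (fstar f0 e).
Local Notation lift := (lift_cell e).
Local Notation N C := ((Ncell Xs C)%:R : R).
Let Y i := f (Xs i) + eps i.

(** Centering at the child average, and not at the target itself, leaves a signal that depends only
    on the sign [x k]; the variation of the target inside a child is counted as noise. *)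
Definition split_mean (C : cell d) (k : 'I_d) (x : cube d) : R :=
  cell_avg (split_cell C k (x k)) f.

Hypothesis gamma_bounds :
  tau / n%:R <= gamma < (Num.max 0 (Num.sqrt (lam / 2) - Num.sqrt (tau / n%:R))) ^+ 2.
(** The good event. Counts are controlled at the children of nonconstant cells, which with the root
    are the cells that CART reaches; noise is controlled for relevant and irrelevant splits
    alike. *)
Hypothesis counts : forall c k b, nonconst f0 c -> k \notin Jcell c ->
  15 / 16 * (n%:R / (2 ^ #|Jcell c|.+1)%:R) <= N (lift (split_cell c k b)).
Hypothesis noise : forall c k, k \notin Jcell (lift c) ->
  (\sum_i contrast R Xs (lift c) k i * (Y i - split_mean (lift c) k (Xs i))) ^+ 2 < tau.

Let nR0 : 0 < n%:R :> R. Proof. by rewrite ltr0n. Qed.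

(** With equal child averages the contrast of the responses is pure noise, whose square is below
    [tau <= n gamma]. *)
Lemma no_split c k : k \notin Jcell (lift c) ->
  cell_avg (split_cell (lift c) k true) f = cell_avg (split_cell (lift c) k false) f ->
  N (lift c) / n%:R * imp_decrease Xs Y k (lift c) < gamma.
Proof.
move=> kJ E; apply: lt_le_trans (_ : tau / n%:R <= _); last by case/andP: gamma_bounds.
rewrite mulrAC imp_decrease_contrast// ltr_pM2r ?invr_gt0//.
have := noise kJ; under eq_bigr do rewrite mulrBr; rewrite sumrB.
rewrite (sum_contrast_sign Xs (fun b => cell_avg (split_cell (lift c) k b) f))//.
by rewrite E subrr mulr0 subr0.
Qed.

(** The contrast of the responses is the signal [D * dm] up to an error below [sqrt tau]. The signal
    is at least [sqrt (n lam / 2)], and the triangle inequality meets the upper end of the window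
    for [gamma]. *)
Lemma best_split_large c : nonconst f0 c -> exists k, k \notin Jcell c /\
  gamma <= N (lift c) / n%:R * imp_decrease Xs Y (e k) (lift c).
Proof.
move=> cc; have [k [kJ lamle]] := smsp_split e_inj smsp lam0 cc.
exists k; split=> //.
have kJ' : e k \notin Jcell (lift c) by rewrite mem_Jcell_lift.
rewrite mulrAC imp_decrease_contrast//.
have := noise kJ'; under eq_bigr do rewrite mulrBr; rewrite sumrB.
rewrite (sum_contrast_sign Xs (fun b => cell_avg (split_cell (lift c) (e k) b) f))//.
set U := \sum_i _; set D := contrast_scale _ _ _ _; set dm := cell_avg _ _ - _ => noisek.
have lamdm : lam * (2 ^ #|Jcell c|)%:R <= (dm / 2) ^+ 2 by [].
have J0 : 0 < (2 ^ #|Jcell c|)%:R :> R by rewrite ltr0n expn_gt0.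
have D2 : n%:R / (8 * (2 ^ #|Jcell c|)%:R) <= D ^+ 2.
  rewrite contrast_scale_sqr (Ncell_split R Xs kJ') !lift_split//.
  have := counts true cc kJ; have := counts false cc kJ.
  rewrite expnS natrM; set a := N _; set b := N _ => Ha Hb.
  (* [B] is half the expected count of a child; [a >= B] and [b >= B] already give
     [a b / (a + b) >= B / 2]. *)
  pose B : R := n%:R / (4 * (2 ^ #|Jcell c|)%:R).
  have B0 : 0 < B by rewrite divr_gt0// mulr_gt0.
  have E : 15 / 16 * (n%:R / (2 * (2 ^ #|Jcell c|)%:R)) = 15 / 8 * B.
    by rewrite /B; field; rewrite gt_eqF.
  rewrite E in Ha Hb.
  have -> : n%:R / (8 * (2 ^ #|Jcell c|)%:R) = B / 2 by rewrite /B; field; rewrite gt_eqF.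
  rewrite ler_pdivlMr; last by lra.
  have h1 : B * b <= a * b by rewrite ler_wpM2r; lra.
  have h2 : a * B <= a * b by rewrite ler_wpM2l; lra.
  by lra.
(* The power of two in SMSP cancels the loss of sample size with depth. *)
have A2 : n%:R * (lam / 2) <= (D * dm) ^+ 2.
  have -> : n%:R * (lam / 2) = n%:R / (8 * (2 ^ #|Jcell c|)%:R) * (4 * (lam * (2 ^ #|Jcell c|)%:R)).
    by field; rewrite gt_eqF.
  have -> : (D * dm) ^+ 2 = D ^+ 2 * (4 * (dm / 2) ^+ 2) by field.
  by apply: ler_pM => //; [rewrite !mulr_ge0// ltW|lra].
have tau0 : 0 <= tau by apply: le_trans (ltW noisek); exact: sqr_ge0.
have [gl] := andP gamma_bounds.
set p := Num.sqrt (lam / 2); set q := Num.sqrt (tau / n%:R) => gu.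
have p2 : p ^+ 2 = lam / 2 by rewrite sqr_sqrtr// divr_ge0// ltW.
have q2 : q ^+ 2 = tau / n%:R by rewrite sqr_sqrtr// divr_ge0.
rewrite ler_pdivlMr//.
(* If [p <= q] the window ends at 0, so [gamma] is negative and the claim is trivial. *)
have [pq|qp] := leP p q.
  have : Num.max 0 (p - q) = 0 by apply/max_idPl; rewrite subr_le0.
  move=> m0; rewrite m0 expr0n/= in gu.
  by apply: le_trans (sqr_ge0 U); rewrite ltW// nmulr_rlt0.
have m0 : Num.max 0 (p - q) = p - q by apply/max_idPr; rewrite subr_ge0 ltW.
rewrite m0 in gu.
have q0 : 0 <= q by exact: sqrtr_ge0.
have p0 : 0 <= p by exact: sqrtr_ge0.
pose r := Num.sqrt (n%:R : R).
have r2 : r ^+ 2 = n%:R by rewrite sqr_sqrtr.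
have r0 : 0 <= r by exact: sqrtr_ge0.
have A1 : r * p <= `|D * dm|.
  by rewrite -(ler_pXn2r (ltn0Sn 1)) ?nnegrE ?mulr_ge0// exprMn r2 p2 real_normK ?num_real.
have N1 : `|U - D * dm| <= r * q.
  rewrite -(ler_pXn2r (ltn0Sn 1)) ?nnegrE ?mulr_ge0// exprMn r2 q2 real_normK ?num_real//.
  by rewrite mulrCA divff ?gt_eqF// mulr1 ltW.
have U1 : r * (p - q) <= `|U|.
  have := ler_normB (U) (U - D * dm); rewrite opprB addrCA subrr addr0; lra.
apply: le_trans (_ : (r * (p - q)) ^+ 2 <= _).
  by rewrite exprMn r2 mulrC ler_wpM2l// ltW.
by rewrite -[leRHS]real_normK ?num_real// lerXn2r ?nnegrE// mulr_ge0// subr_ge0 ltW.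
Qed.

Definition atom_count z : R := \sum_(i | restr e (Xs i) == z) 1.
Definition atom_noise z : R := \sum_(i | restr e (Xs i) == z) eps i.

Lemma sum_atoms c (F : 'I_n -> R) : \sum_(i | in_cell (lift c) (Xs i)) F i =
  \sum_(z | in_cell c z) \sum_(i | restr e (Xs i) == z) F i.
Proof.
rewrite (partition_big (fun i => restr e (Xs i)) (in_cell c))/=; last first.
  by move=> i; rewrite in_lift_cell.
apply: eq_bigr => z cz; apply: eq_bigl => i; rewrite in_lift_cell//.
by case: eqP => [->|]; rewrite ?cz ?andbF.
Qed.

Lemma atom_count_ge0 z : 0 <= atom_count z.
Proof. by apply: sumr_ge0. Qed.

Lemma atom_noise0 z : atom_count z = 0 -> atom_noise z = 0.
Proof.
move=> /eqP; rewrite psumr_eq0// => /allP H; rewrite /atom_noise big1// => i iz.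
by have := H i (mem_index_enum i); rewrite iz oner_eq0.
Qed.

(** On a constant cell the error is the mean noise [SS / N]. Cauchy-Schwarz over the atoms replaces
    [SS^2] by [N Q], and the count bound absorbs the remaining [1 / N]. Bounding by a sum over atoms
    makes the estimate additive over leaves. *)
Lemma leaf_error c : ~~ nonconst f0 c ->
  15 / 16 * (n%:R / (2 ^ #|Jcell c|)%:R) <= N (lift c) ->
  \sum_(x | in_cell (lift c) x) (mean_resp Xs Y (lift c) - f x) ^+ 2 <=
  (2 ^ d)%:R * (16 / (15 * n%:R)) *
    \sum_(z | in_cell c z) atom_noise z ^+ 2 / atom_count z.
Proof.
move=> cc Nc.
have J0 : 0 < (2 ^ #|Jcell c|)%:R :> R by rewrite ltr0n expn_gt0.
have N0 : 0 < N (lift c).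
  by apply: lt_le_trans Nc; rewrite !(mulr_gt0, divr_gt0).
set SS := \sum_(z | in_cell c z) atom_noise z.
have NE : N (lift c) = \sum_(z | in_cell c z) atom_count z.
  by rewrite NcellE sum_atoms.
have err x : in_cell (lift c) x -> mean_resp Xs Y (lift c) - f x = SS / N (lift c).
  move=> cx; rewrite /mean_resp.
  rewrite (eq_bigr (fun i => f x * 1 + eps i)); last first.
    move=> i ci; rewrite mulr1 /Y; congr (_ + _).
    by apply: (constP cc); [move: ci|move: cx]; rewrite in_lift_cell.
  rewrite big_split/= -mulr_sumr -NcellE sum_atoms -/SS.
  by field; rewrite gt_eqF.
rewrite (eq_bigr _ (fun x cx => congr1 (fun a => a ^+ 2) (err x cx))).
rewrite sumr_const -[leLHS]mulr_natl.
have -> : #|[pred x | in_cell (lift c) x]|%:R = (2 ^ d)%:R / (2 ^ #|Jcell c|)%:R :> R.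
  rewrite -(card_cell (lift c)) card_Jcell_lift// natrM mulfK ?gt_eqF//; congr (_%:R).
  by apply: eq_card => x; rewrite !inE.
have := sum_sqr_div_le (in_cell c) atom_count_ge0 atom_noise0.
rewrite -/SS -NE; set Q := \sum_(z | _) _ => titu.
have Q0 : 0 <= Q.
  by apply: sumr_ge0 => z _; rewrite divr_ge0 ?sqr_ge0 ?atom_count_ge0.
rewrite -!mulrA ler_wpM2l// expr_div_n.
apply: le_trans (_ : (2 ^ #|Jcell c|)%:R^-1 * (Q / N (lift c)) <= _).
  rewrite ler_wpM2l ?invr_ge0//.
  rewrite ler_pdivrMr ?exprn_gt0// [leRHS](_ : _ = N (lift c) * Q)//.
  by field; rewrite gt_eqF.
have H : (2 ^ #|Jcell c|)%:R^-1 / N (lift c) <= 16 / (15 * n%:R).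
  rewrite -invfM -[leRHS]invrK invf_div lef_pV2 ?posrE ?divr_gt0 ?mulr_gt0//.
  rewrite -(ler_pM2l J0) in Nc; apply: le_trans Nc.
  by rewrite le_eqVlt; apply/orP; left; apply/eqP; field; rewrite gt_eqF.
rewrite [leLHS](_ : _ = (2 ^ #|Jcell c|)%:R^-1 / N (lift c) * Q); last by ring.
by rewrite [leRHS]mulrA ler_wpM2r.
Qed.

(** A constant cell becomes a leaf; a nonconstant one is split on a relevant coordinate, and
    [counts] passes the count condition to its children. Since [|J(c)| <= s], the fuel condition
    prevents running out of fuel. *)
Lemma cart_go_error fuel c : (s < fuel + #|Jcell c|)%N ->
  15 / 16 * (n%:R / (2 ^ #|Jcell c|)%:R) <= N (lift c) ->
  \sum_(x | in_cell (lift c) x) (cart_go Xs Y gamma fuel (lift c) x - f x) ^+ 2 <=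
  (2 ^ d)%:R * (16 / (15 * n%:R)) *
    \sum_(z | in_cell c z) atom_noise z ^+ 2 / atom_count z.
Proof.
elim: fuel c => [|fuel IH] c.
  by rewrite add0n ltnNge -[s in (_ <= s)%N]card_ord max_card.
move=> fc Nc /=.
have [cc|cc] := boolP (nonconst f0 c); last first.
  case bk: (best_split Xs Y (lift c)) => [k|].
    have kJ := best_split_some bk.
    (* Both averages equal the value at one point of the cell, whose free coordinates are set to
       [false]. *)
    have E b : cell_avg (split_cell (lift c) k b) f = f0 [ffun j => odflt false (c j)].
      rewrite -[RHS](cell_avg_cst (split_cell (lift c) k b)); apply: eq_cell_avg => x.
      rewrite in_split_cell// in_lift_cell// => /andP[cx _].
      apply: (constP cc) => //; apply/forallP => j; rewrite ffunE.
      by case: (c j).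
    by rewrite no_split// ?E//; exact: leaf_error.
  exact: leaf_error.
have [k0 [k0J k0g]] := best_split_large cc.
have k0J' : e k0 \notin Jcell (lift c) by rewrite mem_Jcell_lift.
have [k bk kmax] := best_split_max Xs Y k0J'.
have kJ := best_split_some bk.
have kg : gamma <= N (lift c) / n%:R * imp_decrease Xs Y k (lift c).
  by apply: le_trans k0g _; rewrite ler_wpM2l// divr_ge0.
rewrite bk ltNge kg /=.
(* The winning split passes the threshold, which [no_split] excludes for an irrelevant coordinate;
   hence the children are again lifted cells. *)
have [/imsetP[k1 _ kk1]|kS] := boolP (k \in Sstar e); last first.
  have := no_split kJ (cell_avg_split_out f0 e_inj c kS).
  by rewrite ltNge kg.
subst k; have k1J : k1 \notin Jcell c by rewrite -(mem_Jcell_lift e_inj).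
have step b : \sum_(x | in_cell (split_cell (lift c) (e k1) b) x)
    (cart_go Xs Y gamma fuel (split_cell (lift c) (e k1) (x (e k1))) x - f x) ^+ 2 <=
  (2 ^ d)%:R * (16 / (15 * n%:R)) *
    \sum_(z | in_cell (split_cell c k1 b) z) atom_noise z ^+ 2 / atom_count z.
  rewrite (eq_bigr (fun x => (cart_go Xs Y gamma fuel (lift (split_cell c k1 b)) x - f x) ^+ 2)).
    rewrite lift_split//; apply: IH.
      by rewrite card_Jcell_split// addnS -addSn.
    by rewrite card_Jcell_split//; exact: counts.
  by move=> x; rewrite in_split_cell// => /andP[_ /eqP ->]; rewrite lift_split.
rewrite (sum_cell_split _ kJ) (sum_cell_split _ k1J) mulrDr.
exact: lerD.
Qed.

Lemma risk_cart_le : risk (cart Xs Y gamma) f <=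
  16 / (15 * n%:R) * \sum_z atom_noise z ^+ 2 / atom_count z.
Proof.
have root_in m (x : cube m) : in_cell (root_cell m) x.
  by apply/forallP => j; rewrite ffunE.
have J0 : Jcell (root_cell s) = finset.set0.
  by apply/setP => k; rewrite !inE ffunE.
have := @cart_go_error d.+1 (root_cell s).
rewrite J0 cards0 lift_root// (eq_bigl predT) => [|x]; last by rewrite root_in.
rewrite [X in _ <= _ * X](eq_bigl predT) => [|x]; last by rewrite root_in.
move=> H; rewrite /risk mulrC ler_pdivrMr; last by rewrite ltr0n expn_gt0.
rewrite mulrC mulrA; apply: H.
  rewrite addn0 ltnS; have := leq_card e e_inj; by rewrite !card_ord.
rewrite NcellE (eq_bigl predT) => [|i]; last by rewrite root_in.
rewrite sumr_const card_ord expn0 divr1 mulrC ler_piMr ?ltW//; lra.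
Qed.
End Deterministic.

(** * Exponential inequalities *)

Section ExpBounds.
Variable R : realType.
Implicit Types (x y z h : R).

Lemma expR_le_of_mul y b : y < 1 -> 1 <= (1 - y) * b -> expR y <= b.
Proof.
move=> y1 yb; apply: le_trans (_ : (1 - y)^-1 <= _); last first.
  by rewrite -[leLHS]mul1r ler_pdivrMr ?subr_gt0// mulrC.
rewrite -[expR y]invrK -expRN lef_pV2 ?posrE ?expR_gt0 ?subr_gt0//.
exact: expR_ge1Dx.
Qed.

(** The linear term disappears when averaged over a centered variable, leaving a sub-Gaussian bound.
    For [y <= 1/2] both sides are compared with [1 + y + 2 y^2]; beyond that [y <= 2 y^2]. *)
Lemma expR_le_linear_sqr y : expR y <= y + expR (2 * y ^+ 2).
Proof.
have e2 : 1 + 2 * y ^+ 2 <= expR (2 * y ^+ 2) := expR_ge1Dx _.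
have [y2|y2] := leP y (1 / 2).
  apply: le_trans (_ : 1 + y + 2 * y ^+ 2 <= _); last by lra.
  by apply: expR_le_of_mul; [lra|nra].
apply: le_trans (_ : expR (2 * y ^+ 2) <= _); last by lra.
by rewrite ler_expR; nra.
Qed.

(** The one-step bound [20/21] would be too weak for [avg_count_tail]; eight factors are sharp
    enough. *)
Lemma expR_N20 : expR (- (1 / 20)) <= (160 / 161) ^+ 8 :> R.
Proof.
have -> : - (1 / 20) = 8%:R * (- (1 / 160)) :> R by lra.
rewrite expRM_natl lerXn2r ?nnegrE ?expR_ge0//.
by apply: expR_le_of_mul; lra.
Qed.

Lemma expR1_lower : 5 / 2 <= expR 1 :> R.
Proof.
have -> : 1 = 6%:R * (1 / 6) :> R by lra.
rewrite expRM_natl; apply: le_trans (_ : (7 / 6) ^+ 6 <= _); first by lra.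
by rewrite lerXn2r ?nnegrE ?expR_ge0//; have := expR_ge1Dx (1 / 6 : R); lra.
Qed.

Lemma expR1_upper : expR 1 <= 3 :> R.
Proof.
have -> : 1 = 6%:R * (1 / 6) :> R by lra.
rewrite expRM_natl; apply: le_trans (_ : (6 / 5) ^+ 6 <= _); last by lra.
by rewrite lerXn2r ?nnegrE ?expR_ge0//; apply: expR_le_of_mul; lra.
Qed.

(** The index shifted by [J] runs over the integers from [-J] to [J]. A finite grid keeps this a
    finite sum of exponentials of linear forms. *)
Definition grid_exp (J : nat) z : R :=
  \sum_(j < J + J.+1) expR (2 * (j%:R - J%:R) * z - 3 * (j%:R - J%:R) ^+ 2).

Lemma grid_exp_ge J (j : 'I_(J + J.+1)) z a :
  a <= 2 * (j%:R - J%:R) * z - 3 * (j%:R - J%:R) ^+ 2 -> expR a <= grid_exp J z.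
Proof.
move=> H; rewrite /grid_exp (bigD1 j)//=.
apply: le_trans (_ : _ <= expR (2 * (j%:R - J%:R) * z - 3 * (j%:R - J%:R) ^+ 2)) _.
  by rewrite ler_expR.
by rewrite lerDl sumr_ge0// => i _; exact: expR_ge0.
Qed.

(** Completing the square, [2 j z - 3 j^2 = z^2/3 - 3 (j - z/3)^2], and the integer nearest to [z/3]
    loses at most [3/4]. When [|z| > 3 J] an end of the grid gives at least [3 J^2], hence the cap
    [h]. *)
Lemma grid_exp_lower J z h : h <= 3 * J%:R ^+ 2 ->
  expR (Num.min (z ^+ 2 / 3) h - 3 / 4) <= grid_exp J z.
Proof.
move=> hJ; have m1 : Num.min (z ^+ 2 / 3) h <= z ^+ 2 / 3 by rewrite ge_min lexx.
have m2 : Num.min (z ^+ 2 / 3) h <= h by rewrite ge_min lexx orbT.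
have J0 : 0 <= J%:R :> R by [].
have [zJ|zJ] := ltP (3 * J%:R) z.
  have jJ : (J + J < J + J.+1)%N by rewrite ltn_add2l.
  by apply: (@grid_exp_ge _ (Ordinal jJ)); rewrite /= natrD; nra.
have [zJ'|zJ'] := ltP z (- (3 * J%:R)).
  have jJ : (0 < J + J.+1)%N by rewrite addnS.
  by apply: (@grid_exp_ge _ (Ordinal jJ)); rewrite /=; nra.
(* Truncating [y] rounds [z/3] to a nearest integer, shifted by [J]. *)
pose y := z / 3 + J%:R + 1 / 2.
have y0 : 0 <= y by rewrite /y; lra.
have /andP[k1 k2] := Num.Theory.truncn_itv y0.
have kJ : (Num.truncn y < J + J.+1)%N.
  rewrite -(ltr_nat R); apply: le_lt_trans k1 _.
  by rewrite natrD -addn1 natrD /y; lra.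
apply: (@grid_exp_ge _ (Ordinal kJ)) => /=.
move: k2; rewrite -addn1 natrD => k2.
set k := (Num.truncn y)%:R in k1 k2 *.
rewrite /y in k1 k2.
have : (k - J%:R - z / 3) ^+ 2 <= 1 / 4 by nra.
by nra.
Qed.

(** Since [(j+1)^2 >= j+1], a geometric series with ratio at most [2/5] dominates. Two such tails
    and the central term make [7/3] below. *)
Lemma sum_expRN_sqr_pos (m : nat) :
  \sum_(j < m) expR (- (j.+1%:R : R) ^+ 2) <= 2 / 3.
Proof.
set q : R := expR (-1).
have q0 : 0 < q := expR_gt0 _.
have q1 : q <= 2 / 5.
  have := expRxMexpNx_1 (1 : R); have := expR1_lower; rewrite -/q; nra.
apply: le_trans (_ : \sum_(j < m) q ^+ j.+1 <= _).
  apply: ler_sum => j _; rewrite /q -expRM_natl mulrN1 ler_expR lerN2 expr2.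
  by rewrite -[leLHS]mul1r ler_wpM2r// ler1n.
have H : (1 - q) * \sum_(j < m) q ^+ j.+1 = q * (1 - q ^+ m).
  elim: m => [|m IH]; first by rewrite big_ord0 expr0 subrr !mulr0.
  by rewrite big_ord_recr/= mulrDr IH !exprS; ring.
have qm : 0 <= q ^+ m by rewrite exprn_ge0// ltW.
have p1 : 0 < 1 - q by lra.
rewrite -(ler_pM2l p1) H; nra.
Qed.

Lemma sum_expRN_sqr J :
  \sum_(j < J + J.+1) expR (- (j%:R - J%:R : R) ^+ 2) <= 7 / 3.
Proof.
rewrite big_split_ord /= big_ord_recl /= addn0 subrr expr0n/= oppr0 expR0.
rewrite (reindex_inj rev_ord_inj) /=.
rewrite (eq_bigr (fun j : 'I_J => expR (- (j.+1%:R : R) ^+ 2))); last first.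
  move=> j _; rewrite natrB ?ltn_ord//; congr (expR (- _)).
  by rewrite -sqrrN; congr (_ ^+ 2); lra.
rewrite [X in _ + (_ + X)](eq_bigr (fun j : 'I_J => expR (- (j.+1%:R : R) ^+ 2))).
  have := sum_expRN_sqr_pos J; lra.
move=> j _; congr (expR (- _ ^+ 2)); rewrite natrD /bump /=; lra.
Qed.

(** The cap is harmless: either one coordinate reaches it and alone supplies [h], or no coordinate
    does and the uncapped sum is at least [h]. *)
Lemma prod_grid_exp_lower (I : finType) J (zeta : I -> R) h :
  0 <= h -> h <= 3 * J%:R ^+ 2 -> 3 * h <= \sum_i zeta i ^+ 2 ->
  expR (h - 3 / 4 * #|I|%:R) <= \prod_i grid_exp J (zeta i).
Proof.
move=> h0 hJ H.
apply: le_trans (_ : \prod_i expR (Num.min (zeta i ^+ 2 / 3) h - 3 / 4) <= _); last first.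
  by apply: ler_prod => i _; rewrite expR_ge0 grid_exp_lower.
rewrite -expR_sum ler_expR sumrB sumr_const -[(3 / 4) *+ _]mulr_natr lerD2r.
have m0 i : 0 <= Num.min (zeta i ^+ 2 / 3) h.
  by rewrite le_min h0 divr_ge0 ?sqr_ge0.
have [/existsP[i hi]|] := boolP [exists i, h <= zeta i ^+ 2 / 3].
  rewrite (bigD1 i)//=; apply: le_trans (_ : Num.min (zeta i ^+ 2 / 3) h <= _).
    by rewrite le_min hi lexx.
  by rewrite lerDl sumr_ge0.
rewrite negb_exists => /forallP H'.
rewrite (eq_bigr (fun i => zeta i ^+ 2 / 3)) => [|i _].
  by rewrite -mulr_suml; lra.
by apply/min_idPl; rewrite ltW// ltNge.
Qed.

End ExpBounds.

(** * Averages over designs *)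

Section Averages.
Variables (R : realType) (d n : nat).
Local Notation design := {ffun 'I_n -> cube d}.

Definition avg_design (F : design -> R) : R := (2 ^ d)%:R^-1 ^+ n * \sum_x F x.

Lemma le_avg_design (F G : design -> R) :
  (forall x, F x <= G x) -> avg_design F <= avg_design G.
Proof.
by move=> FG; rewrite ler_wpM2l ?exprn_ge0 ?invr_ge0// ler_sum.
Qed.

Lemma avg_design_prod (g : cube d -> R) :
  avg_design (fun x => \prod_i g (x i)) = ((2 ^ d)%:R^-1 * \sum_y g y) ^+ n.
Proof.
rewrite /avg_design -(bigA_distr_bigA (fun (i : 'I_n) y => g y)).
by rewrite prodr_const card_ord exprMn.
Qed.

Lemma avg_design_cst (a : R) : avg_design (fun=> a) = a.
Proof.
rewrite /avg_design sumr_const card_ffun card_ord card_ffun card_bool card_ord.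
have : (0 < 2 ^ d)%N by rewrite expn_gt0.
move: (2 ^ d)%N => D D0; rewrite -[a *+ _]mulr_natl natrX mulrA -exprMn.
by rewrite mulVf ?expr1n ?mul1r// pnatr_eq0 -lt0n.
Qed.

Lemma avg_designM (a : R) F : avg_design (fun x => a * F x) = a * avg_design F.
Proof. by rewrite /avg_design -mulr_sumr mulrCA. Qed.

(** Chernoff bound with parameter [1/20] at [15/16] of the mean count, [15/320] being their product.
    The exponent closes because [15/320 + (160/161)^8 - 1 <= -1/640]. *)
Lemma avg_count_tail (C : cell d) :
  avg_design (fun x => expR (15 / 320 * (n%:R / (2 ^ #|Jcell C|)%:R) - (Ncell x C)%:R / 20)) <=
  expR (- (n%:R / (2 ^ #|Jcell C|)%:R) / 640).
Proof.
set p : R := (2 ^ #|Jcell C|)%:R^-1.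
have d0 : (2 ^ d)%:R != 0 :> R by rewrite pnatr_eq0 -lt0n expn_gt0.
have pE : p = (2 ^ d)%:R^-1 * #|[set y | in_cell C y]%SET|%:R.
  rewrite -(card_cell C) natrM /p; field.
  by rewrite !pnatr_eq0 -!lt0n expn_gt0 card_cell_gt0.
have p0 : 0 <= p by rewrite invr_ge0.
rewrite (_ : (fun x => _) = (fun x : design => expR (15 / 320 * (n%:R * p)) *
    \prod_i expR (- (1 / 20) * (in_cell C (x i))%:R))); last first.
  apply/funext => x; rewrite expRD; congr (_ * _).
  rewrite -expR_sum -mulr_sumr; congr expR; rewrite NcellE big_mkcond/=.
  rewrite (eq_bigr (fun i => (in_cell C (x i))%:R)) => [|i _]; first by lra.
  by case: in_cell.
rewrite avg_designM (avg_design_prod (fun y => expR (- (1 / 20) * (in_cell C y)%:R))).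
have -> : (2 ^ d)%:R^-1 * \sum_y expR (- (1 / 20) * (in_cell C y)%:R) =
    1 + p * (expR (- (1 / 20)) - 1).
  rewrite (eq_bigr (fun y => 1 + (in_cell C y)%:R * (expR (- (1 / 20)) - 1))); last first.
    by move=> y _; case: in_cell; rewrite /= ?mulr1n ?mulr0n ?mulr1 ?mulr0 ?expR0; lra.
  rewrite big_split/= -mulr_suml sumr_const card_ffun card_bool card_ord mulrDr mulVf//.
  congr (_ + _); rewrite mulrA; congr (_ * _); rewrite pE; congr (_ * _).
  rewrite -sum1_card natr_sum big_mkcond/= [RHS]big_mkcond/=.
  by apply: eq_bigr => y _; rewrite inE; case: in_cell.
apply: le_trans (_ : expR (15 / 320 * (n%:R * p)) *
    expR (n%:R * (p * (expR (- (1 / 20)) - 1))) <= _).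
  rewrite ler_wpM2l ?expR_ge0// expRM_natl lerXn2r ?nnegrE ?expR_ge0//.
    have : expR (- (1 / 20)) <= 1 :> R by rewrite expR_le1; lra.
    have : 0 <= expR (- (1 / 20)) :> R by exact: expR_ge0.
    have : p <= 1 by rewrite invf_le1 ?ltr0n ?expn_gt0// ler1n expn_gt0.
    by nra.
  exact: expR_ge1Dx.
rewrite -expRD ler_expR.
have := expR_N20 R; have : 0 <= n%:R * p by rewrite mulr_ge0.
rewrite [n%:R * (p * _)]mulrA; nra.
Qed.

(* Conditioning on the labels [lab (x i)], the coordinates stay independent and
   uniform on the label classes. *)
Lemma avg_design_label (K : finType) (lab : cube d -> K)
  (a : design -> 'I_n -> R) (g : cube d -> R) (V : R) :
  (forall x x' : design, (forall i, lab (x i) = lab (x' i)) -> a x =1 a x') ->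
  (forall (x : design) i, \sum_(y | lab y == lab (x i)) expR (a x i * g y) <=
     \sum_(y | lab y == lab (x i)) expR (V * a x i ^+ 2)) ->
  avg_design (fun x => expR (\sum_i a x i * g (x i))) <=
  avg_design (fun x => expR (V * \sum_i a x i ^+ 2)).
Proof.
move=> alab H; rewrite ler_wpM2l ?exprn_ge0 ?invr_ge0//.
pose L (x : design) : {ffun 'I_n -> K} := [ffun i => lab (x i)].
rewrite (partition_big L predT)//= [leRHS](partition_big L predT)//=.
apply: ler_sum => p _.
have [x0 /eqP x0p|np] := pickP (fun x => L x == p); last by rewrite !big_pred0.
have aE x : L x == p -> a x =1 a x0.
  move=> /eqP xp; apply: alab => i.
  by move: xp; rewrite -x0p => /ffunP/(_ i); rewrite !ffunE.
have fam (F : 'I_n -> cube d -> R) : \sum_(x | L x == p) \prod_i F i (x i) =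
    \prod_i \sum_(y | lab y == lab (x0 i)) F i y.
  rewrite (bigA_distr_big_dep (fun i y => lab y == lab (x0 i))).
  apply: eq_bigl => x; apply/eqP/familyP => [xp i|xx].
    by move: xp; rewrite -x0p => /ffunP/(_ i); rewrite !ffunE => <-; rewrite unfold_in /= eqxx.
  rewrite -x0p; apply/ffunP => i; rewrite !ffunE.
  by have := xx i; rewrite unfold_in => /eqP.
rewrite (eq_bigr (fun x : design => \prod_i expR (a x0 i * g (x i)))); last first.
  by move=> x xp; rewrite -expR_sum; congr expR; apply: eq_bigr => i _; rewrite aE.
rewrite [leRHS](eq_bigr (fun x : design => \prod_i expR (V * a x0 i ^+ 2))); last first.
  by move=> x xp; rewrite -expR_sum mulr_sumr; congr expR; apply: eq_bigr => i _; rewrite aE.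
rewrite (fam (fun i y => expR (a x0 i * g y))) (fam (fun i _ => expR (V * a x0 i ^+ 2))).
apply: ler_prod => i _; rewrite H andbT.
by apply: sumr_ge0 => y _; exact: expR_ge0.
Qed.

(** A Hoeffding-type bound through [expR_le_linear_sqr], whose linear term sums to zero. *)
Lemma sum_expR_centered (I : finType) (A : pred I) (g : I -> R) (D u : R) :
  \sum_(y | A y) g y = 0 -> (forall y, A y -> `|g y| <= D) ->
  \sum_(y | A y) expR (u * g y) <= \sum_(y | A y) expR (2 * D ^+ 2 * u ^+ 2).
Proof.
move=> g0 gD; apply: le_trans (_ : \sum_(y | A y) (u * g y + expR (2 * D ^+ 2 * u ^+ 2)) <= _).
  apply: ler_sum => y Ay; apply: le_trans (expR_le_linear_sqr _) _.
  rewrite lerD2l ler_expR -mulrA ler_wpM2l// exprMn mulrC ler_wpM2r ?sqr_ge0//.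
  by rewrite -real_normK ?num_real// lerXn2r ?nnegrE// ?gD//; apply: le_trans (gD y Ay).
by rewrite big_split/= -mulr_sumr g0 mulr0 add0r.
Qed.

(** The contrast coefficients depend only on cell membership and the split sign. Given these labels,
    the target minus its child average is centered and bounded by [2 M], and [2 (2 M)^2 = 8 M^2]. *)
Lemma avg_contrast (f : cube d -> R) (M : R) (C : cell d) k (t : R) :
  (forall x, `|f x| <= M) -> k \notin Jcell C ->
  avg_design (fun x => expR (t * \sum_i contrast R x C k i *
    (f (x i) - cell_avg (split_cell C k (x i k)) f))) <=
  expR (8 * M ^+ 2 * t ^+ 2).
Proof.
move=> fM kC.
pose lab (y : cube d) := (in_cell C y, y k).
pose a (x : design) i := t * contrast R x C k i.
pose g (y : cube d) := f y - cell_avg (split_cell C k (y k)) f.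
apply: le_trans (_ : avg_design (fun x => expR (8 * M ^+ 2 * \sum_i a x i ^+ 2)) <= _).
  rewrite (_ : (fun x => _) = (fun x => expR (\sum_i a x i * g (x i)))); last first.
    apply/funext => x; rewrite mulr_sumr; congr expR.
    by apply: eq_bigr => i _; rewrite mulrA.
  apply: (@avg_design_label _ lab) => [x x' E i|x i].
    have Ein j : in_cell C (x j) = in_cell C (x' j) by case: (E j).
    have Ek j : x j k = x' j k by case: (E j).
    have EN : (Ncell x C)%:R = (Ncell x' C)%:R :> R.
      by rewrite !NcellE; apply: eq_bigl => j; rewrite Ein.
    have ENs b : (Ncell x (split_cell C k b))%:R = (Ncell x' (split_cell C k b))%:R :> R.
      by rewrite !NcellE; apply: eq_bigl => j; rewrite !in_split_cell// Ein Ek.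
    by rewrite /a /contrast Ein Ek /contrast_scale EN !ENs.
  have [xC|xC] := boolP (in_cell C (x i)); last first.
    by apply: ler_sum => y _; rewrite /a /contrast (negbTE xC) mulr0 mul0r expr0n/= mulr0.
  have labE y : (lab y == lab (x i)) = in_cell (split_cell C k (x i k)) y.
    by rewrite /lab xpair_eqE xC eqb_id in_split_cell.
  rewrite !(eq_bigl _ _ labE).
  rewrite (_ : 8 * M ^+ 2 = 2 * (2 * M) ^+ 2); last by ring.
  have gE y : in_cell (split_cell C k (x i k)) y ->
      g y = f y - cell_avg (split_cell C k (x i k)) f.
    by rewrite in_split_cell// /g => /andP[_ /eqP ->].
  apply: sum_expR_centered.
    rewrite (eq_bigr _ gE) sumrB -cell_avgE sumr_const mulr_natl.
    rewrite (@eq_card _ _ [set y | in_cell (split_cell C k (x i k)) y]%SET) ?subrr// => y.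
    by rewrite inE.
  move=> y yC; rewrite gE//; apply: le_trans (ler_normB _ _) _.
  by rewrite mulr2n mulrDl mul1r lerD// norm_cell_avg_le.
rewrite -(avg_design_cst (expR (8 * M ^+ 2 * t ^+ 2))); apply: le_avg_design => x.
rewrite ler_expR; apply: ler_wpM2l; first by rewrite pmulr_rge0 ?sqr_ge0.
rewrite (eq_bigr (fun i => t ^+ 2 * contrast R x C k i ^+ 2)) => [|i _]; last by rewrite exprMn.
by rewrite -mulr_sumr ler_piMr ?sqr_ge0// sum_contrast_sqr.
Qed.

End Averages.

(** * Tail bounds *)

Section MeanLe.
Variables (R : realType) (dT : measure_display) (T : measurableType dT).
Variable P : probability T R.
Implicit Types F G : T -> R.

(** Bundles the side conditions for adding integrals of nonnegative functions, so that tail bounds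
    combine by arithmetic on [B]. *)
Definition mean_le F (B : R) := [/\ measurable_fun setT F, forall w, 0 <= F w &
  (\int[P]_w (F w)%:E <= B%:E)%E].

Lemma mean_leD F G A B : mean_le F A -> mean_le G B -> mean_le (fun w => F w + G w) (A + B).
Proof.
move=> [mF F0 FA] [mG G0 GB]; split; first exact: measurable_funD.
  by move=> w; rewrite addr_ge0.
under eq_integral do rewrite EFinD.
rewrite ge0_integralD//=.
- by rewrite EFinD leeD.
- by move=> w _; rewrite lee_fin.
- exact/measurable_EFinP.
- by move=> w _; rewrite lee_fin.
- exact/measurable_EFinP.
Qed.

Lemma mean_leZ F B (c : R) : 0 <= c -> mean_le F B -> mean_le (fun w => c * F w) (c * B).
Proof.
move=> c0 [mF F0 FB]; split; first exact: measurable_funM.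
  by move=> w; rewrite mulr_ge0.
under eq_integral do rewrite EFinM.
rewrite ge0_integralZl_EFin//.
- by rewrite EFinM lee_wpmul2l ?lee_fin.
- by move=> w _; rewrite lee_fin.
- exact/measurable_EFinP.
Qed.

Lemma mean_le_cst (c : R) : 0 <= c -> mean_le (fun=> c) c.
Proof.
move=> c0; split=> //; rewrite integral_cst//.
by rewrite [X in (_ * X)%E](@probability_setT _ _ _ P) mule1.
Qed.

Lemma mean_le_sum (I : finType) (A : pred I) (F : I -> T -> R) (B : I -> R) :
  (forall i, A i -> mean_le (F i) (B i)) ->
  mean_le (fun w => \sum_(i | A i) F i w) (\sum_(i | A i) B i).
Proof.
move=> H; under eq_fun do rewrite -big_filter; rewrite -big_filter.
have : forall i, i \in [seq i <- index_enum I | A i] -> mean_le (F i) (B i).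
  by move=> i; rewrite mem_filter => /andP[Ai _]; exact: H.
elim: [seq i <- index_enum I | A i] => [|i r IH] Hr.
  by under eq_fun do rewrite big_nil; rewrite big_nil; exact: mean_le_cst.
under eq_fun do rewrite big_cons; rewrite big_cons; apply: mean_leD.
  by apply: Hr; rewrite mem_head.
by apply: IH => j jr; apply: Hr; rewrite in_cons jr orbT.
Qed.

Lemma mean_le_weaken F (A B : R) : A <= B -> mean_le F A -> mean_le F B.
Proof. by move=> AB [mF F0 FA]; split=> //; apply: le_trans FA _; rewrite lee_fin. Qed.

Lemma mean_le_exp (d n : nat) (X : 'I_n -> T -> cube d) (eps : 'I_n -> T -> R) (sigma B : R)
  (a : {ffun 'I_n -> cube d} -> 'I_n -> R) b :
  cart_model P X eps sigma ->
  avg_design (fun x => expR (b x + sigma ^+ 2 / 2 * \sum_i a x i ^+ 2)) <= B ->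
  mean_le (fun w => expR (\sum_i a (design X w) i * eps i w + b (design X w))) B.
Proof.
move=> model aB; split; first exact: measurable_exp_linear model _ _.
  by move=> w; exact: expR_ge0.
by apply: le_trans (expectation_exp_linear model a b) _; rewrite lee_fin.
Qed.
End MeanLe.

Section Tails.
Variables (R : realType) (dT : measure_display) (T : measurableType dT).
Variables (P : probability T R) (d s n : nat).
Variables (X : 'I_n -> T -> cube d) (eps : 'I_n -> T -> R) (sigma : R).
Variables (f0 : cube s -> R) (e : 'I_s -> 'I_d).
Hypothesis e_inj : injective e.
Hypothesis model : cart_model P X eps sigma.
Local Notation f := (fstar f0 e).
Local Notation M := (supnorm f).
Local Notation lift := (lift_cell e).
Local Notation x_ w := (design X w).

Lemma count_tail (c : cell s) (l : R) :
  640 * l <= n%:R / (2 ^ #|Jcell c|)%:R ->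
  mean_le P (fun w => expR (15 / 320 * (n%:R / (2 ^ #|Jcell c|)%:R) -
    (Ncell (x_ w) (lift c))%:R / 20)) (expR (- l)).
Proof.
move=> lc.
pose b (x : {ffun 'I_n -> cube d}) : R :=
  15 / 320 * (n%:R / (2 ^ #|Jcell c|)%:R) - (Ncell x (lift c))%:R / 20.
(* Counts carry no noise; zero coefficients give the shape that [mean_le_exp] expects. *)
rewrite (_ : (fun w => _) = (fun w => expR (\sum_i 0 * eps i w + b (x_ w)))); last first.
  by apply/funext => w; rewrite big1 ?add0r// => i _; rewrite mul0r.
apply: (mean_le_exp (a := fun _ _ => 0) (b := b) model).
rewrite (_ : (fun x => _) = (fun x => expR (b x))); last first.
  by apply/funext => x; rewrite big1 ?mulr0 ?addr0// => i _; rewrite expr0n.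
have := avg_count_tail R n (lift c); rewrite card_Jcell_lift// => /le_trans; apply.
by rewrite ler_expR; lra.
Qed.

Definition split_noise (c : cell s) (k : 'I_d) (x : 'I_n -> cube d) (u : 'I_n -> R) : R :=
  \sum_i contrast R x (lift c) k i * (f (x i) + u i - split_mean f0 e (lift c) k (x i)).

(** The noise contributes [sigma^2 t^2 / 2] and the design [8 M^2 t^2], the contrast having norm at
    most 1. *)
Lemma split_noise_tail c k (t l : R) : k \notin Jcell (lift c) ->
  (9 * M ^+ 2 + sigma ^+ 2) * t ^+ 2 <= l ->
  mean_le P (fun w => expR (t * split_noise c k (x_ w) (eps^~ w))) (expR l).
Proof.
move=> kJ tl.
pose a (x : {ffun 'I_n -> cube d}) i := t * contrast R x (lift c) k i.
pose b (x : {ffun 'I_n -> cube d}) := t * \sum_i contrast R x (lift c) k i *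
   (f (x i) - cell_avg (split_cell (lift c) k (x i k)) f).
rewrite (_ : (fun w => _) = (fun w => expR (\sum_i a (x_ w) i * eps i w + b (x_ w)))); last first.
  apply/funext => w; congr expR; rewrite /b !mulr_sumr -big_split/=.
  by apply: eq_bigr => i _; rewrite /a /split_mean; ring.
apply: (mean_le_exp (a := a) (b := b) model).
apply: le_trans (_ : avg_design (fun x => expR (sigma ^+ 2 / 2 * t ^+ 2) * expR (b x)) <= _).
  apply: le_avg_design => x; rewrite -expRD ler_expR addrC lerD2r.
  apply: ler_wpM2l; first by rewrite divr_ge0 ?sqr_ge0.
  rewrite (eq_bigr (fun i => t ^+ 2 * contrast R x (lift c) k i ^+ 2)) => [|i _].
    by rewrite -mulr_sumr ler_piMr ?sqr_ge0// sum_contrast_sqr.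
  by rewrite exprMn.
rewrite avg_designM.
apply: le_trans (ler_wpM2l (expR_ge0 _) (avg_contrast n t (supnorm_ge f) kJ)) _.
rewrite -expRD ler_expR; apply: le_trans tl.
have := sqr_ge0 (M * t); have := sqr_ge0 (sigma * t); rewrite !exprMn; lra.
Qed.

(** In use [v = M^2 + sigma^2], positive and at least [sigma^2], so that given the design [zeta] is
    sub-Gaussian with parameter at most 1. It is 0 on an empty atom. *)
Definition zeta (v : R) (x : 'I_n -> cube d) (u : 'I_n -> R) z : R :=
  atom_noise e x u z / Num.sqrt (v * atom_count R e x z).

Lemma zeta_sqr v x u z : 0 < v ->
  v * zeta v x u z ^+ 2 = atom_noise e x u z ^+ 2 / atom_count R e x z.
Proof.
move=> v0; have [N0|N0] := eqVneq (atom_count R e x z) 0.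
  by rewrite /zeta atom_noise0// mul0r expr0n/= mulr0 mul0r.
rewrite /zeta expr_div_n sqr_sqrtr; last by rewrite mulr_ge0 ?atom_count_ge0// ltW.
by field; rewrite N0 gt_eqF.
Qed.

(** The product expands into a sum over assignments of grid points to atoms, each term an
    exponential linear in the noise. Integration costs [2 j^2] per atom against the built-in
    [-3 j^2], and the sum of the [exp (- j^2)] factors again. *)
Lemma grid_tail (v : R) (J : nat) : 0 < v -> sigma ^+ 2 <= v ->
  mean_le P (fun w => \prod_z grid_exp J (zeta v (x_ w) (eps^~ w) z))
    ((7 / 3) ^+ (2 ^ s)).
Proof.
move=> v0 sv.
pose I := {ffun cube s -> 'I_(J + J.+1)}.
pose j (jj : I) z : R := (jj z)%:R - J%:R.
pose a (jj : I) (x : {ffun 'I_n -> cube d}) i : R :=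
  2 * j jj (restr e (x i)) / Num.sqrt (v * atom_count R e x (restr e (x i))).
pose b (jj : I) (x : {ffun 'I_n -> cube d}) : R := - (3 * \sum_z j jj z ^+ 2).
have byatom (F : cube s -> 'I_n -> R) (x : {ffun 'I_n -> cube d}) :
    \sum_i F (restr e (x i)) i = \sum_z \sum_(i | restr e (x i) == z) F z i.
  rewrite (partition_big (fun i => restr e (x i)) predT)//=.
  by apply: eq_bigr => z _; apply: eq_bigr => i /eqP ->.
rewrite (_ : (fun w => _) = (fun w => \sum_(jj : I)
    expR (\sum_i a jj (x_ w) i * eps i w + b jj (x_ w)))); last first.
  apply/funext => w; rewrite /grid_exp bigA_distr_bigA/=.
  apply: eq_bigr => jj _; rewrite -expR_sum; congr expR.
  rewrite (byatom (fun z i => 2 * j jj z / Num.sqrt (v * atom_count R e (x_ w) z) * eps i w)).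
  rewrite /b mulr_sumr -sumrB; apply: eq_bigr => z _.
  rewrite -mulr_sumr -/(atom_noise e (x_ w) (eps^~ w) z) /zeta /j; ring.
apply: mean_le_weaken (_ : \sum_(jj : I) expR (- \sum_z j jj z ^+ 2) <= _) _.
  rewrite (eq_bigr (fun jj : I => \prod_z expR (- j jj z ^+ 2))); last first.
    by move=> jj _; rewrite -expR_sum sumrN.
  rewrite -(bigA_distr_bigA (fun z (k : 'I_(J + J.+1)) => expR (- (k%:R - J%:R) ^+ 2))).
  rewrite prodr_const card_ffun card_bool card_ord lerXn2r ?nnegrE//.
    by apply: sumr_ge0 => k _; exact: expR_ge0.
  exact: sum_expRN_sqr.
apply: mean_le_sum => jj _; apply: (mean_le_exp (a := a jj) (b := b jj) model).
rewrite -[leRHS](avg_design_cst d n); apply: le_avg_design => x; rewrite ler_expR.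
suff H : \sum_i a jj x i ^+ 2 <= 4 / v * \sum_z j jj z ^+ 2.
  have H' : sigma ^+ 2 / 2 * (\sum_i a jj x i ^+ 2) <= 2 * \sum_z j jj z ^+ 2.
    apply: le_trans (_ : sigma ^+ 2 / 2 * (4 / v * \sum_z j jj z ^+ 2) <= _).
      by rewrite ler_wpM2l// divr_ge0 ?sqr_ge0.
    rewrite mulrA ler_wpM2r ?sumr_ge0// => [z _|]; first exact: sqr_ge0.
    rewrite [leLHS](_ : _ = 2 * (sigma ^+ 2 / v)); last by field; rewrite gt_eqF.
    by rewrite ler_piMr// ler_pdivrMr// mul1r.
  by rewrite /b; lra.
rewrite (byatom (fun z i => (2 * j jj z / Num.sqrt (v * atom_count R e x z)) ^+ 2)).
rewrite mulr_sumr; apply: ler_sum => z _.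
rewrite (eq_bigr (fun i => (2 * j jj z / Num.sqrt (v * atom_count R e x z)) ^+ 2 * 1)) => [|i _];
  last by rewrite mulr1.
rewrite -mulr_sumr -/(atom_count R e x z).
have [N0|N0] := eqVneq (atom_count R e x z) 0.
  by rewrite N0 mulr0 mulr_ge0 ?sqr_ge0// divr_ge0// ltW.
rewrite expr_div_n sqr_sqrtr; last by rewrite mulr_ge0 ?atom_count_ge0// ltW.
by rewrite le_eqVlt; apply/orP; left; apply/eqP; field; rewrite N0 gt_eqF.
Qed.
End Tails.

(** * The bad event *)

Lemma le_sum_term (R : realType) (I : finType) (A : pred I) (F : I -> R) i :
  (forall j, 0 <= F j) -> A i -> F i <= \sum_(j | A j) F j.
Proof. by move=> F0 Ai; rewrite (bigD1 i)//= lerDl sumr_ge0. Qed.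

Lemma expR_N_log_count (R : realType) (k : nat) (a : R) : 0 < a ->
  expR (- (k%:R * ln 3 + ln a)) = (3 ^+ k * a)^-1.
Proof.
by move=> a0; rewrite expRN expRD expRM_natl !lnK ?posrE.
Qed.

Section BadEvent.
Variables (R : realType) (dT : measure_display) (T : measurableType dT).
Variables (P : probability T R) (d s n : nat).
Variables (X : 'I_n -> T -> cube d) (eps : 'I_n -> T -> R) (sigma lam delta : R).
Variables (f0 : cube s -> R) (e : 'I_s -> 'I_d).
Hypotheses (d_gt0 : (0 < d)%N) (s_gt0 : (0 < s)%N) (n_gt0 : (0 < n)%N).
Hypothesis e_inj : injective e.
Hypothesis model : cart_model P X eps sigma.
Hypothesis smsp : SMSP (fstar f0 e) (Sstar e) lam.
Hypothesis lam0 : 0 < lam.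
Hypothesis delta01 : 0 < delta < 1.
Local Notation f := (fstar f0 e).
Local Notation M := (supnorm f).
Local Notation lift := (lift_cell e).
Local Notation x_ w := (design X w).
Local Notation t := (tau d s M sigma delta).
Let v := M ^+ 2 + sigma ^+ 2.
Let W := 9 * M ^+ 2 + sigma ^+ 2.
Let L := (s%:R + 1) * ln 3 + ln (2 / delta).
Let l := (s%:R + 2) * ln 3 + ln (2 * d%:R / delta).
Hypothesis v0 : 0 < M ^+ 2 + sigma ^+ 2.
Hypothesis n_large : 8 * t / lam < n%:R.

Let d0 : 0 < delta. Proof. by case/andP: delta01. Qed.
Let d1 : delta < 1. Proof. by case/andP: delta01. Qed.

Let W0 : 0 < W.
Proof. by have := v0; have := sqr_ge0 M; rewrite /v /W; lra. Qed.

Let EL : expR (- L) = delta / (2 * 3 ^+ s.+1).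
Proof.
rewrite /L natr1 expR_N_log_count ?divr_gt0//.
by rewrite invfM invf_div; field; rewrite expf_neq0// pnatr_eq0.
Qed.

Let El : expR (- l) = delta / (2 * d%:R * 3 ^+ s.+2).
Proof.
rewrite /l -[s%:R + 2](natrD _ s 2) addn2 expR_N_log_count ?divr_gt0 ?mulr_gt0 ?ltr0n//.
rewrite invfM invf_div; field.
by rewrite expf_neq0 ?pnatr_eq0// -lt0n d_gt0.
Qed.

Let l0 : 0 < l.
Proof.
have p3 : 0 < 3 ^+ s.+2 :> R by exact: exprn_gt0.
have dR : 0 < d%:R :> R by rewrite ltr0n.
rewrite -oppr_lt0 -expR_lt1 El ltr_pdivrMr ?(mulr_gt0 (mulr_gt0 _ dR) p3)// mul1r.
have : 1 <= d%:R * 3 ^+ s.+2 :> R by rewrite mulr_ege1 ?ler1n// exprn_ege1// ler1n.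
by have := d1; rewrite -mulrA; lra.
Qed.

Let tE : t = 18 * W * l.
Proof. by []. Qed.

Let t0 : 0 < t.
Proof. by rewrite tE !mulr_gt0. Qed.

Let nR0 : 0 < n%:R :> R. Proof. by rewrite ltr0n. Qed.

(** From [n lam > 8 * 18 * 9 M^2 l] and [lam 2^|J(c)| <= M^2] follows [n >= 1296 l 2^|J(c)|], which
    leaves [648 l] for a child. *)
Let leaf_mass c : nonconst f0 c -> 640 * l <= n%:R / (2 ^ #|Jcell c|.+1)%:R.
Proof.
move=> cc; have H := lam_le_supnorm e_inj smsp lam0 cc.
have J0 : 0 < (2 ^ #|Jcell c|)%:R :> R by rewrite ltr0n expn_gt0.
move: n_large; rewrite ltr_pdivrMr// tE => nl.
have M0 : 0 < M ^+ 2 by apply: lt_le_trans H; rewrite mulr_gt0.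
rewrite expnS natrM ler_pdivlMr ?mulr_gt0//.
have W9 : 9 * M ^+ 2 <= W by rewrite /W; have := sqr_ge0 sigma; lra.
have h1 : 9 * M ^+ 2 * l <= W * l by rewrite ler_wpM2r// ltW.
have h2 : n%:R * (lam * (2 ^ #|Jcell c|)%:R) <= n%:R * M ^+ 2 by rewrite ler_wpM2l// ltW.
have h3 : 1296 * M ^+ 2 * l <= n%:R * lam by lra.
have h4 : 1296 * M ^+ 2 * l * (2 ^ #|Jcell c|)%:R <= n%:R * M ^+ 2.
  apply: le_trans h2; rewrite mulrA ler_wpM2r// ltW//.
have h5 : 1296 * l * (2 ^ #|Jcell c|)%:R <= n%:R.
  rewrite -(ler_pM2r M0); apply: le_trans h4; rewrite le_eqVlt; apply/orP; left; apply/eqP; ring.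
have : 0 < l * (2 ^ #|Jcell c|)%:R by rewrite mulr_gt0.
by lra.
Qed.

Let m : R := (2 ^ s)%:R.
(** [5/8] is fixed by the final constant: [16/15 * 3 * 5/8 = 2]. The size of [J] puts the cap [h]
    within reach of the grid. *)
Let h : R := 5 / 8 * m * L.
Let J := (Num.truncn h).+1.
(** Minimiser of the Chernoff exponent [W x^2 - x sqrt t], whose minimum is
    [- t / (4 W) = - 9/2 l]. *)
Let theta : R := Num.sqrt t / (2 * W).
Let big (c : cell s) : bool := 640 * l <= n%:R / (2 ^ #|Jcell c|)%:R.

Let Phi1 (w : T) : R := \sum_(c : cell s | big c)
  expR (15 / 320 * (n%:R / (2 ^ #|Jcell c|)%:R) - (Ncell (x_ w) (lift c))%:R / 20).
Let Phi2 (w : T) : R := \sum_(q : cell s * 'I_d * bool | q.1.2 \notin Jcell (lift q.1.1))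
  expR (- (theta * Num.sqrt t)) *
    expR ((if q.2 then theta else - theta) * split_noise f0 e q.1.1 q.1.2 (x_ w) (eps^~ w)).
Let Phi3 (w : T) : R := expR (3 / 4 * m - h) * \prod_z grid_exp J (zeta e v (x_ w) (eps^~ w) z).

(** There are [3^s] cells, and [3^s exp (- l) = delta / (18 d)]. The three budgets [1/18], [1/9] and
    [5/6] add up to 1. *)
Let E1 : mean_le P Phi1 (delta / 18).
Proof.
apply: mean_le_weaken (_ : \sum_(c : cell s | big c) expR (- l) <= _) _; last first.
  by apply: mean_le_sum => c cb; exact: (count_tail e_inj model cb).
apply: le_trans (_ : \sum_(c : cell s) expR (- l) <= _).
  by rewrite big_mkcond; apply: ler_sum => c _; case: ifP => // _; exact: expR_ge0.
rewrite sumr_const card_ffun card_option card_bool card_ord -[leLHS]mulr_natl natrX El.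
rewrite !exprS [leLHS](_ : _ = delta / 18 / d%:R); last first.
  by field; rewrite expf_neq0 ?pnatr_eq0// -lt0n d_gt0.
by rewrite ler_piMr ?divr_ge0 ?(ltW d0)// invf_le1 ?ler1n// ltr0n.
Qed.

(** Cells, coordinates and signs number [2 d 3^s], and [2 d 3^s exp (- l) = delta / 9]. *)
Let E2 : mean_le P Phi2 (delta / 9).
Proof.
apply: mean_le_weaken
  (_ : \sum_(q : cell s * 'I_d * bool | q.1.2 \notin Jcell (lift q.1.1)) expR (- l) <= _) _;
  last first.
  apply: mean_le_sum => -[[c k] b] /= kJ.
  apply: mean_le_weaken (_ : expR (- (theta * Num.sqrt t)) * expR (W * theta ^+ 2) <= _) _.
    rewrite -expRD ler_expR /theta.
    have t2 : Num.sqrt t ^+ 2 = t by rewrite sqr_sqrtr// ltW.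
    rewrite (_ : _ + _ = - (Num.sqrt t ^+ 2 / (4 * W))); last by field; rewrite gt_eqF.
    rewrite t2 tE (_ : _ / _ = 9 / 2 * l); last by field; rewrite gt_eqF.
    by have := l0; lra.
  apply: mean_leZ; first exact: expR_ge0.
  apply: (split_noise_tail model kJ).
  by case: b; rewrite ?sqrrN.
apply: le_trans (_ : \sum_(q : cell s * 'I_d * bool) expR (- l) <= _).
  by rewrite big_mkcond; apply: ler_sum => c _; case: ifP => // _; exact: expR_ge0.
rewrite sumr_const !card_prod card_ffun card_option card_bool !card_ord -[leLHS]mulr_natl.
rewrite !natrM natrX El !exprS le_eqVlt; apply/orP; left; apply/eqP.
by field; rewrite expf_neq0 ?pnatr_eq0// -lt0n d_gt0.
Qed.

(** The mean is at most [B^(2^s)]. Since [B <= 1] and [s >= 1] it suffices to bound [B^2], where one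
    factor [exp (- L)] supplies [delta] and the remaining [exp (- L / 4) <= 1/2] beats the
    constants. *)
Let E3 : mean_le P Phi3 (5 / 6 * delta).
Proof.
have sv : sigma ^+ 2 <= v by rewrite /v; have := sqr_ge0 M; lra.
have H := mean_leZ (expR_ge0 (3 / 4 * m - h)) (grid_tail e model J v0 sv).
apply: (mean_le_weaken _ H) => {H}.
pose B := 7 / 3 * expR (3 / 4 - 5 / 8 * L).
have -> : expR (3 / 4 * m - h) * (7 / 3) ^+ (2 ^ s) = B ^+ (2 ^ s).
  rewrite [RHS]exprMn mulrC; congr (_ * _); rewrite -expRM_natl; congr expR.
  by rewrite /h -/m; ring.
have B0 : 0 <= B by rewrite mulr_ge0 ?expR_ge0.
have ELle : expR (- L) <= delta / 18.
  rewrite EL ler_wpM2l ?(ltW d0)// lef_pV2 ?posrE ?mulr_gt0 ?exprn_gt0//.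
  have : (3 : R) ^+ 2 <= 3 ^+ s.+1 by rewrite ler_weXn2l ?ler1n// ltnS.
  by rewrite expr2; lra.
have B2 : B ^+ 2 <= 5 / 6 * delta.
  have -> : B ^+ 2 = 49 / 9 * expR (3 / 2) * (expR (- L) * expR (- (L / 4))).
    rewrite [LHS]exprMn -expRM_natl -[RHS]mulrA -!expRD; congr (_ * expR _); last by field.
    by rewrite expr2; lra.
  have e32 : expR (3 / 2) <= 26 / 5 :> R.
    rewrite -(ler_pXn2r (ltn0Sn 1)) ?nnegrE ?expR_ge0// -expRM_natl.
    rewrite (_ : 2%:R * (3 / 2) = 3%:R * 1 :> R); last by lra.
    rewrite expRM_natl; apply: le_trans (_ : (3 : R) ^+ 3 <= _); last by lra.
    by rewrite lerXn2r ?nnegrE ?expR_ge0// expR1_upper.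
  have e4 : expR (- (L / 4)) <= 1 / 2.
    rewrite -(ler_pXn2r (ltn0Sn 3)) ?nnegrE ?expR_ge0// -expRM_natl.
    rewrite (_ : 4%:R * - (L / 4) = - L); last by lra.
    by have := d1; lra.
  apply: le_trans (_ : 49 / 9 * (26 / 5) * (delta / 18 * (1 / 2)) <= _); last first.
    by have := d0; lra.
  by rewrite ler_pM ?mulr_ge0 ?expR_ge0// ?ler_wpM2l// ler_pM ?expR_ge0.
have B1 : B <= 1.
  rewrite -(ler_pXn2r (ltn0Sn 1)) ?nnegrE// expr1n.
  by apply: le_trans B2 _; have := d1; lra.
apply: le_trans B2; apply: ler_wiXn2l => //.
by have : (2 ^ 1 <= 2 ^ s)%N by rewrite leq_exp2l.
Qed.

(** A function of small mean serves twice: Markov's inequality gives the probability bound, and the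
    same function multiplies the crude bound in the expected risk. It is the same for every
    admissible [gamma]. *)
Lemma cart_bad_event : exists2 Phi, mean_le P Phi delta &
  forall w gamma,
    t / n%:R <= gamma < (Num.max 0 (Num.sqrt (lam / 2) - Num.sqrt (t / n%:R))) ^+ 2 ->
    Phi w < 1 -> cart_risk f0 e gamma X eps w <=
      (2 ^ s.+1)%:R * (M ^+ 2 + sigma ^+ 2) * ((s%:R + 1) * ln 3 + ln (2 / delta)) / n%:R.
Proof.
exists (fun w => Phi1 w + Phi2 w + Phi3 w).
  apply: (mean_le_weaken _ (mean_leD (mean_leD E1 E2) E3)); lra.
move=> w gamma gb lt1.
have [_ P1 _] := E1; have [_ P2 _] := E2; have [_ P3 _] := E3.
have {P1 P2 P3 lt1} [lt1 lt2 lt3] : [/\ Phi1 w < 1, Phi2 w < 1 & Phi3 w < 1].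
  by have := P1 w; have := P2 w; have := P3 w; split; lra.
have -> : cart_risk f0 e gamma X eps w =
    risk (cart (x_ w) (fun i => f (x_ w i) + eps i w) gamma) f.
  rewrite /cart_risk.
  have E : (fun i => X i w) = x_ w by apply/funext => i; rewrite ffunE.
  by rewrite -!E.
apply: le_trans (risk_cart_le (lam := lam) (tau := t) e_inj smsp lam0 n_gt0 gb _ _) _.
- move=> c k b cc kJ.
  have kc : big (split_cell c k b) by rewrite /big card_Jcell_split// leaf_mass.
  have : expR (15 / 320 * (n%:R / (2 ^ #|Jcell (split_cell c k b)|)%:R) -
    (Ncell (x_ w) (lift (split_cell c k b)))%:R / 20) < 1 :> R.
    apply: (le_lt_trans _ lt1).
    by apply: (le_sum_term (A := big) (F := fun c => expR (15 / 320 *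
      (n%:R / (2 ^ #|Jcell c|)%:R) - (Ncell (x_ w) (lift c))%:R / 20))) kc => c'; exact: expR_ge0.
  by rewrite expR_lt1 card_Jcell_split//; lra.
- move=> c k kJ.
  (* The two signs of [theta] together bound the absolute value of the contrast. *)
  have U b : (if b then theta else - theta) * split_noise f0 e c k (x_ w) (eps^~ w) <
      theta * Num.sqrt t.
    rewrite -subr_lt0 -expR_lt1 addrC expRD; apply: (le_lt_trans _ lt2).
    apply: (le_sum_term (A := fun q : cell s * 'I_d * bool => q.1.2 \notin Jcell (lift q.1.1))
      (F := fun q => expR (- (theta * Num.sqrt t)) * expR ((if q.2 then theta else - theta) *
         split_noise f0 e q.1.1 q.1.2 (x_ w) (eps^~ w))) (i := (c, k, b))) => [q|//].
    by apply: mulr_ge0; exact: expR_ge0.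
  have th0 : 0 < theta by rewrite divr_gt0 ?mulr_gt0// sqrtr_gt0.
  have := U true; have := U false; rewrite mulNr -mulrN !ltr_pM2l// => u1 u2.
  rewrite -/(split_noise f0 e c k (x_ w) (eps^~ w)).
  rewrite -[ltRHS]sqr_sqrtr ?(ltW t0)// -real_normK ?num_real//.
  by rewrite ltrXn2r ?nnegrE ?sqrtr_ge0//= ltr_norml; apply/andP; split; lra.
have L0 : 0 <= L.
  have p3 : 0 < 3 ^+ s.+1 :> R by exact: exprn_gt0.
  rewrite -oppr_le0 -expR_le1 EL ler_pdivrMr ?(mulr_gt0 _ p3)// mul1r.
  have : 1 <= 3 ^+ s.+1 :> R by rewrite exprn_ege1// ler1n.
  by have := d1; lra.
have m0 : 0 < m by rewrite ltr0n expn_gt0.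
have h0 : 0 <= h by rewrite !mulr_ge0// ltW.
have hJ : h <= 3 * J%:R ^+ 2.
  have /andP[_ hJ] := Num.Theory.truncn_itv h0.
  have J1 : 1 <= J%:R :> R by rewrite ler1n.
  by apply: le_trans (ltW hJ) _; rewrite -/J; nra.
(* Otherwise [prod_grid_exp_lower] would cancel the prefactor of [Phi3] and give [Phi3 >= 1]. *)
have zs : \sum_z zeta e v (x_ w) (eps^~ w) z ^+ 2 < 3 * h.
  rewrite ltNge; apply/negP => zs.
  have := prod_grid_exp_lower h0 hJ zs; rewrite card_ffun card_bool card_ord -/m => H.
  move: lt3; rewrite ltNge => /negP; apply; rewrite /Phi3.
  apply: le_trans (ler_wpM2l (expR_ge0 _) H); rewrite -expRD.
  by rewrite (_ : _ + _ = 0) ?expR0//; ring.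
under eq_bigr do rewrite -(zeta_sqr _ _ _ _ v0).
rewrite -mulr_sumr; apply: le_trans (_ : 16 / (15 * n%:R) * (v * (3 * h)) <= _).
  apply: ler_wpM2l; first by rewrite divr_ge0// mulr_ge0// ltW.
  by rewrite ler_pM2l// ltW.
rewrite -/v -/L /h expnS natrM -/m le_eqVlt; apply/orP; left; apply/eqP; field.
by rewrite gt_eqF.
Qed.
End BadEvent.

(** * Crude risk bound and the noiseless case *)

Lemma norm_mean_resp_le (R : realType) (d n : nat) (Xs : 'I_n -> cube d) (Y : 'I_n -> R) (D : R) C :
  0 <= D -> (forall i, `|Y i| <= D) -> `|mean_resp Xs Y C| <= D.
Proof.
move=> D0 YD; rewrite /mean_resp.
have [N0|N0] := eqVneq ((Ncell Xs C)%:R : R) 0; first by rewrite N0 invr0 mul0r normr0.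
have Np : 0 < (Ncell Xs C)%:R :> R by rewrite lt0r N0 /=.
rewrite normrM normfV (gtr0_norm Np) mulrC ler_pdivrMr//.
apply: le_trans (ler_norm_sum _ _ _) _.
apply: le_trans (ler_sum _ (fun i _ => YD i)) _.
by rewrite NcellE mulr_sumr; apply: ler_sum => i _; rewrite mulr1.
Qed.

Lemma cart_go_mean (R : realType) (d n : nat) (Xs : 'I_n -> cube d) (Y : 'I_n -> R)
  (gamma : R) fuel C x : exists C', cart_go Xs Y gamma fuel C x = mean_resp Xs Y C'.
Proof.
elim: fuel C => [|fuel IH] C /=; first by exists C.
case: best_split => [k|]; last by exists C.
by case: ifP => _; [exists C|exact: IH].
Qed.

Lemma le_risk (R : realType) (d : nat) (g f : cube d -> R) (B : R) :
  (forall x, (g x - f x) ^+ 2 <= B) -> risk g f <= B.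
Proof.
move=> H; rewrite /risk mulrC ler_pdivrMr ?ltr0n ?expn_gt0//.
apply: le_trans (ler_sum _ (fun x _ => H x)) _.
by rewrite sumr_const card_ffun card_bool card_ord mulr_natr.
Qed.

Lemma risk_ge0 (R : realType) (d : nat) (g f : cube d -> R) : 0 <= risk g f.
Proof. by rewrite mulr_ge0 ?invr_ge0// sumr_ge0// => x _; exact: sqr_ge0. Qed.

(** Every prediction is a mean of responses, so the error is at most [2 M + sqrt B], whose square is
    at most [8 M^2 + 2 B]. *)
Lemma cart_risk_crude (R : realType) (dT : measure_display) (T : measurableType dT)
  (d s n : nat) (f0 : cube s -> R) (e : 'I_s -> 'I_d) (gamma B : R)
  (X : 'I_n -> T -> cube d) (eps : 'I_n -> T -> R) w : 0 <= B ->
  (forall i, eps i w ^+ 2 <= B) ->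
  cart_risk f0 e gamma X eps w <= 8 * supnorm (fstar f0 e) ^+ 2 + 2 * B.
Proof.
move=> B0 H; apply: le_risk => x; rewrite /cart; set M := supnorm _.
have M0 : 0 <= M := le_trans (normr_ge0 _) (supnorm_ge (fstar f0 e) x).
have b0 : 0 <= Num.sqrt B := sqrtr_ge0 B.
have b2 : Num.sqrt B ^+ 2 = B by rewrite sqr_sqrtr.
have [C ->] := cart_go_mean (fun i => X i w) (fun i => fstar f0 e (X i w) + eps i w)
  gamma d.+1 (root_cell d) x.
have mD : `|mean_resp (fun i => X i w) (fun i => fstar f0 e (X i w) + eps i w) C| <= M + Num.sqrt B.
  apply: norm_mean_resp_le; first exact: addr_ge0.
  move=> i; apply: le_trans (ler_normD _ _) _; apply: lerD; first exact: supnorm_ge.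
  by rewrite -(ler_pXn2r (ltn0Sn 1)) ?nnegrE// b2 real_normK ?num_real.
have fD := supnorm_ge (fstar f0 e) x; rewrite -/M in fD.
move: mD fD; rewrite !ler_norml => /andP[m1 m2] /andP[f1 f2].
move: b0 b2 m1 m2; set b := Num.sqrt B; set y := mean_resp _ _ _; set z := fstar _ _ _ in f1 f2 *.
move=> b0 <- m1 m2.
have h1 : - (2 * M + b) <= y - z by lra.
have h2 : y - z <= 2 * M + b by lra.
have : (y - z) ^+ 2 <= (2 * M + b) ^+ 2 by nra.
have := sqr_ge0 (2 * M - b); nra.
Qed.

(** When [|y| > b], [y^2 <= 2 b^2 + 2 (|y| - b)^2]; squaring [t z / 2 <= exp (t z / 2)] at
    [z = |y| - b] bounds the excess by an exponential, and the two signs cover [|y|]. *)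
Lemma noise_sqr_le (R : realType) (b t y : R) : 0 < t -> 0 <= b ->
  y ^+ 2 <= 2 * b ^+ 2 + 8 / t ^+ 2 * expR (- (t * b)) * (expR (t * y) + expR (- t * y)).
Proof.
move=> t0 b0.
have E0 : 0 <= 8 / t ^+ 2 * expR (- (t * b)).
  by rewrite mulr_ge0 ?expR_ge0// divr_ge0// sqr_ge0.
have sq z : 0 <= z -> z ^+ 2 <= 4 / t ^+ 2 * expR (t * z).
  move=> z0; have -> : t * z = 2%:R * (t * z / 2) by field.
  rewrite expRM_natl; have h := expR_ge1Dx (t * z / 2).
  have tz : 0 <= t * z by rewrite mulr_ge0// ltW.
  have -> : z ^+ 2 = 4 / t ^+ 2 * (t * z / 2) ^+ 2 by field; rewrite gt_eqF.
  apply: ler_wpM2l; first by rewrite divr_ge0// sqr_ge0.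
  by rewrite lerXn2r ?nnegrE ?expR_ge0//; lra.
have [yb|yb] := leP `|y| b.
  have : y ^+ 2 <= b ^+ 2 by rewrite -real_normK ?num_real// lerXn2r ?nnegrE.
  have : 0 <= 8 / t ^+ 2 * expR (- (t * b)) * (expR (t * y) + expR (- t * y)).
    by rewrite mulr_ge0// addr_ge0 ?expR_ge0.
  by have := sqr_ge0 b; lra.
have h1 := sq (`|y| - b) (ltW _); rewrite subr_gt0 in h1; have {}h1 := h1 yb.
have h2 : expR (t * (`|y| - b)) <= expR (- (t * b)) * (expR (t * y) + expR (- t * y)).
  rewrite mulrBr addrC expRD ler_wpM2l ?expR_ge0//.
  have p1 := expR_ge0 (t * y); have p2 := expR_ge0 (- t * y).
  have [y0|y0] := leP 0 y; first by rewrite ger0_norm// lerDl.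
  by rewrite ltr0_norm// mulrN -mulNr lerDr.
have h3 : y ^+ 2 <= 2 * b ^+ 2 + 2 * (`|y| - b) ^+ 2.
  have := sqr_ge0 (`|y| - 2 * b); rewrite -[y ^+ 2]real_normK ?num_real//; nra.
apply: le_trans h3 _; rewrite lerD2l.
have h4 : 4 / t ^+ 2 * expR (t * (`|y| - b)) <= 4 / t ^+ 2 *
    (expR (- (t * b)) * (expR (t * y) + expR (- t * y))).
  by apply: ler_wpM2l h2; rewrite divr_ge0// sqr_ge0.
by lra.
Qed.

Section NoiseMoment.
Variables (R : realType) (dT : measure_display) (T : measurableType dT).
Variables (P : probability T R) (d n : nat).
Variables (X : 'I_n -> T -> cube d) (eps : 'I_n -> T -> R) (sigma : R).
Hypothesis model : cart_model P X eps sigma.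

(** Summing over the sample gives one bound valid for all indices at once, in place of a maximum. *)
Definition noise_excess (b t : R) (w : T) : R :=
  8 / t ^+ 2 * expR (- (t * b)) * \sum_i (expR (t * eps i w) + expR (- t * eps i w)).

Lemma noise_sqr_le_excess b t w i : 0 < t -> 0 <= b ->
  eps i w ^+ 2 <= 2 * b ^+ 2 + noise_excess b t w.
Proof.
move=> t0 b0; apply: le_trans (noise_sqr_le (eps i w) t0 b0) _.
rewrite lerD2l ler_wpM2l ?mulr_ge0 ?expR_ge0 ?invr_ge0 ?sqr_ge0//.
apply: (le_sum_term (A := predT) (F := fun i => expR (t * eps i w) + expR (- t * eps i w))) => //.
Qed.

Lemma mean_noise_excess b t : mean_le P (noise_excess b t)
  (8 / t ^+ 2 * expR (- (t * b)) * (n%:R * (2 * expR (sigma ^+ 2 * t ^+ 2 / 2)))).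
Proof.
have [_ [meps [_ [mgf _]]]] := model.
have E u i : mean_le P (fun w => expR (u * eps i w)) (expR (sigma ^+ 2 * u ^+ 2 / 2)).
  split; [|by move=> w; exact: expR_ge0|exact: mgf].
  by apply: measurableT_comp => //; apply: measurable_funM.
apply: mean_leZ; first by rewrite mulr_ge0 ?expR_ge0// divr_ge0// sqr_ge0.
apply: (mean_le_weaken _ (mean_le_sum (A := predT) (fun i _ => mean_leD (E t i) (E (- t) i)))).
by rewrite sqrrN sumr_const card_ord -[leLHS]mulr_natl; apply: ler_wpM2l => //; lra.
Qed.
End NoiseMoment.

Lemma measurable_sublevel (R : realType) (dT : measure_display) (T : measurableType dT)
  (F : T -> R) (B : R) : measurable_fun setT F -> measurable [set w | F w <= B].
Proof.
move=> mF; rewrite -[X in measurable X]setTI.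
exact: (measurable_fun_ler mF (measurable_cst B)).
Qed.

(** Markov's inequality: the indicator of the complement is at most [Phi]. *)
Lemma probability_le_ge (R : realType) (dT : measure_display) (T : measurableType dT)
  (P : probability T R) (F Phi : T -> R) (B delta : R) :
  measurable_fun setT F -> mean_le P Phi delta -> (forall w, Phi w < 1 -> F w <= B) ->
  ((1 - delta)%:E <= P [set w | (F w <= B)%R])%E.
Proof.
move=> mF [mPhi Phi0 EPhi] H.
have mA := measurable_sublevel B mF.
set A := [set w | F w <= B] in mA *.
have PA : (P (~` A) <= delta%:E)%E.
  apply: le_trans EPhi; rewrite -[X in P X]setIT -integral_indic//; last exact: measurableC.
  apply: ge0_le_integral => //.
  - by apply/measurable_EFinP/measurable_indic; exact: measurableC.
  - exact/measurable_EFinP.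
  move=> w _; rewrite lee_fin indicE; have [|] := boolP (w \in ~` A) => // wA.
  rewrite leNgt; apply/negP => /H FB; move: wA; rewrite inE; exact.
move: PA; rewrite probability_setC//.
have : P A \is a fin_num by exact: fin_num_measure.
case: (P A) => // p _; rewrite -EFinB !lee_fin; lra.
Qed.

Section Degenerate.
Variables (R : realType) (dT : measure_display) (T : measurableType dT).
Variables (P : probability T R) (d s n : nat).
Variables (X : 'I_n -> T -> cube d) (eps : 'I_n -> T -> R) (sigma gamma : R).
Variables (f0 : cube s -> R) (e : 'I_s -> 'I_d).
Hypothesis model : cart_model P X eps sigma.
Hypothesis v0 : supnorm (fstar f0 e) ^+ 2 + sigma ^+ 2 = 0.

Let M0 : supnorm (fstar f0 e) ^+ 2 = 0.
Proof. by move: v0 => /eqP; rewrite paddr_eq0 ?sqr_ge0// => /andP[/eqP]. Qed.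

Let sigma0 : sigma ^+ 2 = 0.
Proof. by move: v0 => /eqP; rewrite paddr_eq0 ?sqr_ge0// => /andP[_ /eqP]. Qed.

(** With [sigma = 0] the exponential moments are at most 1 for every parameter [t], so the excess
    over [b = 0] has mean of order [n / t^2], and [t] may grow. *)
Lemma degenerate_integral : (\int[P]_w (cart_risk f0 e gamma X eps w)%:E = 0)%E.
Proof.
apply/eqP; rewrite eq_le; apply/andP; split; last first.
  by apply: integral_ge0 => w _; rewrite lee_fin risk_ge0.
apply/lee_addgt0Pr => r r0; rewrite add0e.
(* Makes the bound [32 n / t^2] at most [r]; the [+ 1] keeps [t] positive for [n = 0]. *)
pose t : R := Num.sqrt ((32 * n%:R + 1) / r).
have n0 : 0 < 32 * n%:R + 1 :> R by rewrite ltr_wpDl// mulr_ge0.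
have t0 : 0 < t by rewrite sqrtr_gt0 divr_gt0.
have t2 : t ^+ 2 = (32 * n%:R + 1) / r by rewrite sqr_sqrtr// divr_ge0// ltW.
have [mE E0 EE] := mean_leZ (ler0n R 2) (mean_noise_excess model 0 t).
apply: le_trans (le_trans EE _); last first.
  rewrite lee_fin mulr0 oppr0 expR0 sigma0 !mul0r expR0 t2 !mulr1 invf_div.
  rewrite [leLHS](_ : _ = r * (32 * n%:R / (32 * n%:R + 1))); last first.
    by field; rewrite gt_eqF.
  by rewrite ler_piMr ?(ltW r0)// ler_pdivrMr// mul1r lerDl.
apply: ge0_le_integral => //.
- by move=> w _; rewrite lee_fin risk_ge0.
- by apply/measurable_EFinP; exact: measurable_cart_risk model.
- exact/measurable_EFinP.
move=> w _; rewrite lee_fin.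
have ex0 : 0 <= noise_excess eps 0 t w by have := E0 w; rewrite pmulr_rge0.
rewrite (_ : 2 * _ = 8 * supnorm (fstar f0 e) ^+ 2 + 2 * noise_excess eps 0 t w);
  last by rewrite M0 mulr0 add0r.
apply: cart_risk_crude => // i.
by have := noise_sqr_le_excess eps w i t0 (lexx 0); rewrite expr0n/= mulr0 add0r.
Qed.

Lemma degenerate_probability : P [set w | cart_risk f0 e gamma X eps w <= 0] = 1%E.
Proof.
have mF : measurable_fun setT (EFin \o cart_risk f0 e gamma X eps).
  by apply/measurable_EFinP; exact: measurable_cart_risk model.
have : (\int[P]_w `|(EFin \o cart_risk f0 e gamma X eps) w| = 0)%E.
  rewrite -degenerate_integral; apply: eq_integral => w _ /=.
  by rewrite ger0_norm// risk_ge0.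
move=> /(ae_eq_integral_abs P measurableT mF) [N [mN N0 HN]].
set A := [set w | _].
have mA : measurable A.
  by apply: measurable_sublevel; exact: measurable_cart_risk model.
have : P (~` A) = 0%E.
  apply: (@subset_measure0 _ _ _ P _ N) => //; first exact: measurableC.
  move=> w wA; apply: HN => /= H; apply: wA; rewrite /A /=.
  by have := H I => -[->].
rewrite probability_setC//.
have : P A \is a fin_num by exact: fin_num_measure.
by case: (P A) => // p _; rewrite -EFinB => -[] /eqP; rewrite subr_eq0 => /eqP <-.
Qed.
End Degenerate.

(** * Expected risk *)

Lemma ln2_ge_half (R : realType) : 1 / 2 <= ln 2 :> R.
Proof.
rewrite -ler_expR lnK ?posrE// -(ler_pXn2r (ltn0Sn 1)) ?nnegrE ?expR_ge0//.
rewrite -expRM_natl (_ : 2%:R * (1 / 2) = 1 :> R); last by lra.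
by have := expR1_upper R; lra.
Qed.

Lemma ln3_le2 (R : realType) : ln 3 <= 2 :> R.
Proof. by rewrite -ler_expR lnK ?posrE//; have := expR_ge1Dx (2 : R); lra. Qed.

Lemma tau_ge0 (R : realType) d s (M sigma delta : R) : (0 < d)%N -> 0 < delta < 1 ->
  0 <= tau d s M sigma delta.
Proof.
move=> d0 /andP[dl0 dl1]; rewrite /tau mulr_ge0//.
  by have := sqr_ge0 M; have := sqr_ge0 sigma; lra.
rewrite addr_ge0 ?mulr_ge0 ?ln_ge0 ?addr_ge0// ?ler1n//.
rewrite ler_pdivlMr// mul1r; apply: le_trans (ltW dl1) _.
by rewrite -(natrM _ 2 d) ler1n muln_gt0.
Qed.

(** The factor 8 gives [2 sqrt (t / n) < sqrt (lam / 2)], so the difference of the roots exceeds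
    [sqrt (t / n)]. *)
Lemma gamma_window (R : realType) (lam t : R) (n : nat) : (0 < n)%N -> 0 < lam -> 0 <= t ->
  8 * t / lam < n%:R ->
  t / n%:R < (Num.max 0 (Num.sqrt (lam / 2) - Num.sqrt (t / n%:R))) ^+ 2.
Proof.
move=> n0 lam0 t0; have nR : 0 < n%:R :> R by rewrite ltr0n.
rewrite ltr_pdivrMr// => H.
have tn : t / n%:R < lam / 2 / 4 by rewrite ltr_pdivrMr//; lra.
set p := Num.sqrt (lam / 2); set q := Num.sqrt (t / n%:R).
have p0 : 0 <= p := sqrtr_ge0 _; have q0 : 0 <= q := sqrtr_ge0 _.
have p2 : p ^+ 2 = lam / 2 by rewrite sqr_sqrtr// divr_ge0// ltW.
have q2 : q ^+ 2 = t / n%:R by rewrite sqr_sqrtr// divr_ge0// ltW.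
rewrite -q2 in tn *; rewrite -p2 in tn.
have qp : 2 * q < p.
  by rewrite -(ltr_pXn2r (ltn0Sn 1)) ?nnegrE ?mulr_ge0// exprMn; lra.
by rewrite ltrXn2r ?nnegrE ?le_max ?lexx//= lt_max; apply/orP; right; lra.
Qed.

(** Pointwise, the risk is at most [bnd + K * Phi + 2 * noise_excess]: the first term suffices where
    [Phi < 1], and elsewhere the crude bound is covered by the other two. Here [Phi] has mean at
    most [1/n]. *)
Lemma expected_cart_risk (R : realType) (d s n : nat) (f0 : cube s -> R) (e : 'I_s -> 'I_d)
  (lam sigma gamma : R) (dT : measure_display) (T : measurableType dT)
  (P : probability T R) (X : 'I_n -> T -> cube d) (eps : 'I_n -> T -> R) :
  (0 < d)%N -> (0 < s)%N -> (1 < n)%N -> injective e -> cart_model P X eps sigma ->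
  SMSP (fstar f0 e) (Sstar e) lam -> 0 < lam ->
  let M := supnorm (fstar f0 e) in
  let t := tau d s M sigma n%:R^-1 in
  0 < M ^+ 2 + sigma ^+ 2 -> 8 * t / lam < n%:R ->
  t / n%:R <= gamma < (Num.max 0 (Num.sqrt (lam / 2) - Num.sqrt (t / n%:R))) ^+ 2 ->
  (\int[P]_w (cart_risk f0 e gamma X eps w)%:E <=
   (50 * (2 ^ s)%:R * (M ^+ 2 + sigma ^+ 2) * (s%:R + ln n%:R) / n%:R)%:E)%E.
Proof.
move=> d0 s0 n1 e_inj model smsp lam0 M t v0 nl gb.
have n0 : (0 < n)%N := ltnW n1.
have nR : 0 < n%:R :> R by rewrite ltr0n.
have dl : 0 < (n%:R^-1 : R) < 1 by rewrite invr_gt0 nR invf_lt1// ltr1n.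
have [Phi EPhi HPhi] := cart_bad_event d0 s0 n0 e_inj model smsp lam0 dl v0 nl.
set v := M ^+ 2 + sigma ^+ 2 in v0 *.
have lnn : 1 / 2 <= ln n%:R :> R.
  by apply: le_trans (ln2_ge_half R) _; rewrite ler_ln ?posrE// ler_nat.
have ln0 : 0 < ln n%:R :> R by lra.
(* The choices give [u b = 4 log n] and [sigma^2 u^2 / 2 <= 2 log n], so the excess has mean of
   order [v / (n log n)]. *)
pose w2 : R := 4 * ln n%:R.
have w20 : 0 < w2 by rewrite mulr_gt0.
pose b := Num.sqrt (w2 * v); pose u := Num.sqrt (w2 / v).
have b2 : b ^+ 2 = w2 * v by rewrite sqr_sqrtr// ltW// mulr_gt0.
have u2 : u ^+ 2 = w2 / v by rewrite sqr_sqrtr// ltW// divr_gt0.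
have u0 : 0 < u by rewrite sqrtr_gt0 divr_gt0.
have b0 : 0 <= b by exact: sqrtr_ge0.
have ub : u * b = w2.
  rewrite -sqrtrM; last by rewrite ltW// divr_gt0.
  rewrite (_ : w2 / v * (w2 * v) = w2 ^+ 2); last by field; rewrite gt_eqF.
  by rewrite sqrtr_sqr gtr0_norm.
have M20 : 0 <= M ^+ 2 := sqr_ge0 M.
have Mv : M ^+ 2 <= v by rewrite /v lerDl sqr_ge0.
have sv : sigma ^+ 2 <= v by rewrite /v lerDr.
pose bnd := (2 ^ s.+1)%:R * v * ((s%:R + 1) * ln 3 + ln (2 / n%:R^-1)) / n%:R.
have ln2n : ln (2 / n%:R^-1) = ln 2 + ln n%:R :> R by rewrite invrK lnM ?posrE.
have l2 : 1 / 2 <= ln 2 :> R := ln2_ge_half R.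
have l3 : 0 <= ln 3 :> R by rewrite ln_ge0// ler1n.
have bnd0 : 0 <= bnd.
  rewrite /bnd ln2n !mulr_ge0 ?invr_ge0//; first exact: ltW.
  by rewrite addr_ge0 ?mulr_ge0 ?addr_ge0//; lra.
pose K := 8 * M ^+ 2 + 4 * b ^+ 2.
have K0 : 0 <= K by rewrite /K; have := sqr_ge0 b; lra.
have EX := mean_noise_excess model b u.
have tot := mean_leD (mean_leD (mean_le_cst P bnd0) (mean_leZ K0 EPhi)) (mean_leZ (ler0n R 2) EX).
have [mtot _ Etot] := tot.
have [_ Phi0 _] := EPhi; have [_ ex0 _] := EX.
apply: le_trans (le_trans Etot _).
  apply: ge0_le_integral => //.
  - by move=> w _; rewrite lee_fin risk_ge0.
  - by apply/measurable_EFinP; exact: measurable_cart_risk model.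
  - exact/measurable_EFinP.
  move=> w _; rewrite lee_fin; have P0 := Phi0 w; have E0 := ex0 w.
  have KP0 : 0 <= K * Phi w by rewrite mulr_ge0.
  have [P1|P1] := ltP (Phi w) 1.
    by apply: le_trans (HPhi w gamma gb P1) _; rewrite -/M -/v -/bnd; lra.
  have c := cart_risk_crude f0 e gamma X (w := w)
    (addr_ge0 (mulr_ge0 (ler0n R 2) (sqr_ge0 b)) E0)
    (fun i => noise_sqr_le_excess eps w i u0 b0).
  apply: le_trans c _; rewrite -/M.
  have KP : K <= K * Phi w by rewrite ler_peMr.
  by move: KP; rewrite {1}/K; lra.
rewrite lee_fin u2 ub.
have e4 : expR (- w2) = n%:R ^- 4.
  by rewrite expRN /w2 expRM_natl lnK ?posrE.
have e2 : expR (sigma ^+ 2 * (w2 / v) / 2) <= n%:R ^+ 2.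
  rewrite -[n%:R in leRHS]lnK ?posrE// -expRM_natl ler_expR.
  rewrite (_ : _ / 2 = sigma ^+ 2 / v * (2 * ln n%:R)); last first.
    by rewrite /w2; field; rewrite gt_eqF.
  by rewrite ler_piMl ?mulr_ge0 ?(ltW ln0)// ler_pdivrMr// mul1r.
set S2 := (2 ^ s)%:R : R.
have S21 : 1 <= S2 by rewrite ler1n expn_gt0.
have s1 : 1 <= s%:R :> R by rewrite ler1n.
have lnn2 : ln 2 <= ln n%:R :> R by rewrite ler_ln ?posrE// ler_nat.
apply: le_trans (_ : (2 * S2 * v * (4 * s%:R + 2 * ln n%:R) + (8 * v + 16 * ln n%:R * v) + 16 * v)
   / n%:R <= _).
  rewrite [leRHS]mulrDl [X in _ <= X + _]mulrDl; apply: lerD; [apply: lerD|].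
  - rewrite /bnd expnS natrM -/S2 ler_wpM2r ?invr_ge0//; apply: ler_wpM2l.
      by rewrite !mulr_ge0// ltW.
    rewrite ln2n; have := ln3_le2 R => l32.
    have : (s%:R + 1) * ln 3 <= (s%:R + 1) * 2 :> R by apply: ler_wpM2l => //; rewrite addr_ge0.
    by lra.
  - rewrite ler_wpM2r ?invr_ge0// /K b2 /w2; lra.
  rewrite e4 (_ : 8 / (w2 / v) = 2 * v / ln n%:R); last first.
    by rewrite /w2; field; rewrite !gt_eqF.
  apply: le_trans (_ : 2 * (2 * v / ln n%:R * n%:R ^- 4 * (n%:R * (2 * n%:R ^+ 2))) <= _).
    rewrite ler_wpM2l// ler_wpM2l ?mulr_ge0 ?invr_ge0 ?exprn_ge0 ?(ltW v0) ?(ltW ln0)//.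
    by rewrite ler_wpM2l// ler_wpM2l.
  rewrite [leLHS](_ : _ = 8 * v * (ln n%:R)^-1 / n%:R); last first.
    by field; rewrite !gt_eqF.
  rewrite ler_wpM2r ?invr_ge0//.
  have : (ln n%:R)^-1 <= 2 :> R by rewrite -[leRHS]invrK lef_pV2 ?posrE//; lra.
  by move=> h; have : v * (ln n%:R)^-1 <= v * 2 by [rewrite ler_wpM2l// ltW]; lra.
(* The coefficients collect to at most 32 for [s] and 20 for [log n], both below 50. *)
rewrite ler_wpM2r ?invr_ge0//.
have h1 : v <= S2 * v by rewrite ler_peMl// ltW.
have h2 : S2 * v <= S2 * v * s%:R by rewrite ler_peMr// mulr_ge0// ltW.
have h3 : v * ln n%:R <= S2 * v * ln n%:R by rewrite ler_wpM2r// ltW.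
have h4 : 0 <= S2 * v * ln n%:R by rewrite !mulr_ge0// ltW.
lra.
Qed.

Theorem theoremH3 (R : realType) :
  (forall (d s n : nat) (f0 : cube s -> R) (e : 'I_s -> 'I_d)
     (lam delta sigma : R)
     (dT : measure_display) (T : measurableType dT) (P : probability T R)
     (X : 'I_n -> T -> cube d) (eps : 'I_n -> T -> R),
   (0 < d)%N -> (0 < s)%N -> (0 < n)%N -> injective e ->
   cart_model P X eps sigma ->
   SMSP (fstar f0 e) (Sstar e) lam -> 0 < lam ->
   0 < delta < 1 ->
   let M := supnorm (fstar f0 e) in
   let t := tau d s M sigma delta in
   8 * t / lam < n%:R ->
   (exists gamma : R,
      t / n%:R <= gamma < (Num.max 0 (Num.sqrt (lam / 2) - Num.sqrt (t / n%:R))) ^+ 2) /\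
   (forall gamma : R,
      t / n%:R <= gamma < (Num.max 0 (Num.sqrt (lam / 2) - Num.sqrt (t / n%:R))) ^+ 2 ->
      ((1 - delta - expR (s%:R * ln 3 - n%:R / (2 ^ (s + 3))%:R))%:E <=
       P [set w | (cart_risk f0 e gamma X eps w <=
                  (2 ^ s.+1)%:R * (M ^+ 2 + sigma ^+ 2)
                    * ((s%:R + 1) * ln 3 + ln (2 / delta)) / n%:R)%R])%E))
  /\
  (exists C : R, 0 < C /\
   forall (d s n : nat) (f0 : cube s -> R) (e : 'I_s -> 'I_d)
     (lam sigma gamma : R)
     (dT : measure_display) (T : measurableType dT) (P : probability T R)
     (X : 'I_n -> T -> cube d) (eps : 'I_n -> T -> R),
   (0 < d)%N -> (0 < s)%N -> (0 < n)%N -> injective e ->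
   cart_model P X eps sigma ->
   SMSP (fstar f0 e) (Sstar e) lam -> 0 < lam ->
   let delta := n%:R^-1 in
   0 < delta < 1 ->
   let M := supnorm (fstar f0 e) in
   let t := tau d s M sigma delta in
   8 * t / lam < n%:R ->
   t / n%:R <= gamma < (Num.max 0 (Num.sqrt (lam / 2) - Num.sqrt (t / n%:R))) ^+ 2 ->
   (\int[P]_w (cart_risk f0 e gamma X eps w)%:E <=
    (C * (2 ^ s)%:R * (M ^+ 2 + sigma ^+ 2) * (s%:R + ln n%:R) / n%:R)%:E)%E).
Proof.
split.
  move=> d s n f0 e lam delta sigma dT T P X eps d0 s0 n0 e_inj model smsp lam0 dl M t nl.
  have t0 : 0 <= t by exact: tau_ge0.
  split; first by exists (t / n%:R); rewrite lexx/= gamma_window.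
  move=> gamma gb.
  (* The probability is shown to be at least [1 - delta], which implies the claim. *)
  apply: le_trans (_ : ((1 - delta)%:E <= _)%E).
    by rewrite lee_fin gerBl expR_ge0.
  have mF := measurable_cart_risk f0 e gamma model.
  (* The standardisation of the noise divides by [M^2 + sigma^2]; when this is 0 the claimed risk
     bound is 0 and holds almost surely. *)
  have [v0|v0] := eqVneq (M ^+ 2 + sigma ^+ 2) 0.
    have := degenerate_probability gamma model v0.
    rewrite v0 mulr0 !mul0r => ->.
    by rewrite lee_fin gerBl ltW//; case/andP: dl.
  have {}v0 : 0 < M ^+ 2 + sigma ^+ 2 by rewrite lt0r v0 addr_ge0 ?sqr_ge0.
  have [Phi EPhi HPhi] := cart_bad_event d0 s0 n0 e_inj model smsp lam0 dl v0 nl.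
  by apply: (probability_le_ge mF EPhi) => w; exact: HPhi.
exists 50; split=> // d s n f0 e lam sigma gamma dT T P X eps d0 s0 n0 e_inj model smsp lam0.
move=> delta dl M t nl gb.
have [v0|v0] := eqVneq (M ^+ 2 + sigma ^+ 2) 0.
  by rewrite (degenerate_integral gamma model v0) v0 mulr0 !mul0r.
apply: (expected_cart_risk d0 s0 _ e_inj model smsp lam0 _ nl gb).
  by move: dl => /andP[_]; rewrite /delta invf_lt1 ?ltr0n// ltr1n.
by rewrite lt0r v0 addr_ge0 ?sqr_ge0.
Qed.
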